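(* For all integers $p_1,p_2,q>1$, the quantity $(1+(-1)^{p_1+p_2+q})T_{p_1p_2,q}$ lies in the $\mathbb{Q}$-algebra generated by zeta values, double zeta values and double $\widetilde t$-values, and explicitly \begin{align*} &(1+(-1)^{p_1+p_2+q})T_{p_1p_2,q}\\ &=-T_{p_1,p_2+q}-T_{p_2,p_1+q}-(-1)^{p_1+p_2}(1+(-1)^q)\widetilde{t}(p_1)\widetilde{t}(p_2)\widetilde{t}(q)+(-1)^{p_1}((-1)^{p_2+q}-1)\widetilde{t}(p_1)T_{p_2,q}\\ &\quad+(-1)^{p_2}((-1)^{p_1+q}-1)\widetilde{t}(p_2)T_{p_1,q}-(-1)^{p_1}\widetilde{t}(p_1)\widetilde{t}(p_2+q)-(-1)^{p_2}\widetilde{t}(p_2)\widetilde{t}(p_1+q)\\ &\quad-(-1)^{p_1+p_2}\sum_{l=0}^{p_1+p_2-1}((-1)^l-1)\binom{p_1+p_2+q-l-2}{q-1}\widetilde{t}(l+1)\zeta(p_1+p_2+q-l-1)\\ &\quad+(-1)^{p_1+p_2}\sum_{k=1}^{p_2} (-1)^k \binom{k+p_1-2}{p_1-1} \sum_{l=0}^{p_2-k}((-1)^l-1)\binom{p_2+q-k-l-1}{q-1}\widetilde{t}(l+1)\\ &\qquad\qquad\times \left( \zeta(k+p_1-1)\zeta(p_2+q-k-l)+(-1)^{k+p_1-1}S_{k+p_1-1,p_2+q-k-l}\right)\\ &\quad+(-1)^{p_1+p_2}\sum_{k=1}^{p_1} (-1)^k \binom{k+p_2-2}{p_2-1} \sum_{l=0}^{p_1-k}((-1)^l-1)\binom{p_1+q-k-l-1}{q-1}\widetilde{t}(l+1)\\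 &\qquad\qquad\times \left( \zeta(k+p_2-1)\zeta(p_1+q-k-l)+(-1)^{k+p_2-1}S_{k+p_2-1,p_1+q-k-l}\right)\\ &\quad+(-1)^{p_1+p_2+q} \widetilde{t}(p_1+p_2+q) +(-1)^{p_1}2\sum_{\substack{k_1+2k_2=p_2+q+1\\ k_1,k_2\geq 1}} \binom{p_1+k_1-2}{p_1-1}\zeta(p_1+k_1-1)\widetilde{t}(2k_2)\\ &\quad+(-1)^{p_2}2\sum_{\substack{k_1+2k_2=p_1+q+1\\ k_1,k_2\geq 1}} \binom{p_2+k_1-2}{p_2-1}\zeta(p_2+k_1-1)\widetilde{t}(2k_2)\\ &\quad+(-1)^{p_1+p_2} 2\sum_{\substack{k_1+k_2+2k_3=q+2\\ k_1,k_2,k_3\geq 1}} \binom{p_1+k_1-2}{p_1-1}\binom{p_2+k_2-2}{p_2-1}\zeta(p_1+k_1-1)\zeta(p_2+k_2-1)\widetilde{t}(2k_3). \end{align*}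
   Context: Let $h_n^{(p)}=\sum_{k=1}^n (k-1/2)^{-p}$ for $n\ge0$. Euler $T$-sums: $T_{p,q}=\sum_{n\ge1}\frac{h_{n-1}^{(p)}}{(n-1/2)^q}$ and $T_{p_1p_2,q}=\sum_{n\ge1}\frac{h_{n-1}^{(p_1)}h_{n-1}^{(p_2)}}{(n-1/2)^q}$. Classical Euler sums: $S_{p,q}=\sum_{n\ge1}\frac{H_n^{(p)}}{n^q}$ with $H_n^{(p)}=\sum_{k=1}^n k^{-p}$. For positive integers $s_1,\dots,s_k$ with $s_1>1$: $\widetilde{t}(s_1,\dots,s_k)=\sum_{n_1>\cdots>n_k\ge1}\prod_j (n_j-1/2)^{-s_j}$ and $\zeta(s_1,\dots,s_k)=\sum_{n_1>\cdots>n_k\ge1}\prod_j n_j^{-s_j}$; $\widetilde t(s)=(2^s-1)\zeta(s)$. Terms involving $\widetilde t(1)$ occur only with coefficient $0$. *)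

(* Defs.v *)
From mathcomp Require Import all_boot all_order all_algebra.
From mathcomp Require Import all_classical all_reals all_analysis.

Set Implicit Arguments.
Unset Strict Implicit.
Unset Printing Implicit Defensive.

Import Order.TTheory GRing.Theory Num.Theory.
Import numFieldNormedType.Exports.

Local Open Scope classical_set_scope.
Local Open Scope ring_scope.

Section EulerSums.
Variable R : realType.
Implicit Types (a : R) (s : seq nat) (p q n N : nat).

(* Sum of \prod_j (n_j - a)^-s_j over N > n_1 > ... > n_k >= 1, for
   s = [:: s_1; ...; s_k]. *)
Fixpoint nested_sum a s N : R :=
  if s is p :: s' then
    \sum_(1 <= n < N) (n%:R - a) ^- p * nested_sum a s' n
  else 1.

(* The infinite sums below are limits of their partial sums; limn of a
   divergent sequence is an unspecified real number. *)
Definition zeta s : R := limn (nested_sum 0 s).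

Definition ttilde s : R := limn (nested_sum 2^-1 s).

Definition harm p n : R := \sum_(1 <= k < n.+1) k%:R ^- p.

Definition hharm p n : R := \sum_(1 <= k < n.+1) (k%:R - 2^-1) ^- p.

Definition EulerS p q : R :=
  limn (fun N => \sum_(1 <= n < N.+1) harm p n / n%:R ^+ q : R).

Definition EulerT p q : R :=
  limn (fun N =>
    \sum_(1 <= n < N.+1) hharm p n.-1 / (n%:R - 2^-1) ^+ q : R).

Definition EulerT2 p1 p2 q : R :=
  limn (fun N =>
    \sum_(1 <= n < N.+1)
      hharm p1 n.-1 * hharm p2 n.-1 / (n%:R - 2^-1) ^+ q : R).

Definition Qsubalgebra (A : set R) : Prop :=
  [/\ forall c : rat, A (ratr c),
      forall x y, A x -> A y -> A (x + y)
    & forall x y, A x -> A y -> A (x * y)].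

Definition Qalgebra_generated (G : set R) : set R := smallest Qsubalgebra G.

Definition zeta_values : set R :=
  [set x | exists2 s : nat, (1 < s)%N & x = zeta [:: s]].

Definition double_zeta_values : set R :=
  [set x | exists s1 s2 : nat,
    [/\ (1 < s1)%N, (0 < s2)%N & x = zeta [:: s1; s2]]].

Definition double_ttilde_values : set R :=
  [set x | exists s1 s2 : nat,
    [/\ (1 < s1)%N, (0 < s2)%N & x = ttilde [:: s1; s2]]].

End EulerSums.

Arguments zeta_values : clear implicits.
Arguments double_zeta_values : clear implicits.
Arguments double_ttilde_values : clear implicits.

(* Main.v *)
(* Let f_p(w) be the sum of (k + w)^-p over 0 <= k <= N.  The rational function
   f_p1(w) f_p2(w) w^-q vanishes at infinity, so it is the sum of its principal
   parts at the poles w = 0, -1, ..., -N.  Sum this partial fraction expansion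
   over all half-integers w.  On the right, each (n + w)^-l sums to
   (1 + (-1)^l) ttilde(l), whatever n is (symmetric summation gives 0 for l = 1),
   which leaves a combination of the coefficients of the principal parts: these
   are truncated zeta values at the pole 0 and truncated harmonic numbers at the
   poles -n.  On the left, f_p(w) is a combination of half-integer harmonic
   numbers.  Letting N tend to infinity (dominated convergence, in the form of
   Tannery's theorem) yields the identity multiplied by (-1)^(p1 + p2 + q). *)
Require Import Defs.
From mathcomp Require Import all_boot all_order all_algebra.
From mathcomp Require Import all_classical all_reals all_analysis.
From mathcomp Require Import ring lra zify.
Import Order.TTheory GRing.Theory Num.Theory.
Import numFieldNormedType.Exports.

Local Open Scope classical_set_scope.
Local Open Scope ring_scope.

(** * Partial fractions *)

(** Without truncation, [f_p] is, up to sign and a factorial, a polygamma function, and the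
    classical argument integrates it against [pi tan(pi w)] over large contours. Truncation makes
    the function rational: the residue theorem becomes a finite identity in a field, and no complex
    analysis remains. The price is an iterated limit, over the half-integers at fixed [N] and then
    over [N]. The exchange rests on a bound uniform in [N]: for [p > 1], the truncated [f_p] at a
    half-integer is at most [2 * ttilde(p)] in absolute value, so [w^-q] with [q > 1] dominates.
    Half-integers fit because they avoid every pole and are permuted by integer shifts, so a
    principal part at [-n] sums to the same value as one at [0]. Simple poles do occur on the right,
    and their sums converge only when [w] is paired with [-w]. The pole at [-n] produces two kinds
    of harmonic numbers: the terms [k > n] give [H_(N-n)], which tends to a zeta value, and the
    terms [k < n] are reflected and give [H_n], which stays and builds the sums [S]. *)

Section PartialFractions.
Variable F : fieldType.
Implicit Types (c f g : nat -> F) (u v w d : F) (p q r n i : nat).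

(* The i-th Taylor coefficient at u = 0 of (u + d) ^- p. *)
Definition inv_pow_coef p d i : F :=
  (-1) ^+ i * 'C((p + i).-1, i)%:R * d ^- (p + i).

Definition cauchy_prod f g n : F := \sum_(0 <= i < n.+1) f i * g (n - i)%N.

(** Multiplication of the power series by its variable. *)
Definition delay c i : F := if i is j.+1 then c j else 0.

(* The terms of negative degree of u ^- p * \sum_i c i * u ^+ i. *)
Definition principal_part u c p : F := \sum_(0 <= i < p) c i * u ^- (p - i).

Local Notation al := inv_pow_coef.
Local Notation pp := principal_part.

Lemma inv_sign n : ((-1) ^+ n)^-1 = (-1) ^+ n :> F.
Proof. by rewrite -signr_odd invr_sign. Qed.

Lemma inv_pow_opp u n : (- u) ^- n = (-1) ^+ n * u ^- n.
Proof. by rewrite [in LHS]exprNn invfM inv_sign. Qed.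

Lemma cauchy_prodC f g : cauchy_prod f g = cauchy_prod g f.
Proof.
apply/funext => n; rewrite /cauchy_prod big_nat_rev /= !big_mkord.
by apply: eq_bigr => i _; rewrite add0n subSS mulrC subKn // -ltnS.
Qed.

Lemma cauchy_prod_delayl f g : cauchy_prod (delay f) g = delay (cauchy_prod f g).
Proof.
apply/funext => -[|n]; rewrite /cauchy_prod /=.
  by rewrite big_nat1 mul0r.
by rewrite big_nat_recl //= mul0r add0r.
Qed.

Lemma cauchy_prod_sumr (I : Type) (s : seq I) (P : pred I) f (g : I -> nat -> F) n :
  cauchy_prod f (fun i => \sum_(k <- s | P k) g k i) n
  = \sum_(k <- s | P k) cauchy_prod f (g k) n.
Proof.
rewrite /cauchy_prod exchange_big /=; apply: eq_bigr => i _.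
by rewrite mulr_sumr.
Qed.

Lemma cauchy_prod_suml (I : Type) (s : seq I) (P : pred I) (f : I -> nat -> F) g n :
  cauchy_prod (fun i => \sum_(k <- s | P k) f k i) g n
  = \sum_(k <- s | P k) cauchy_prod (f k) g n.
Proof.
by rewrite cauchy_prodC cauchy_prod_sumr; apply: eq_bigr => k _; rewrite cauchy_prodC.
Qed.

Lemma cauchy_prodDl f1 f2 g n :
  cauchy_prod (fun i => f1 i + f2 i) g n = cauchy_prod f1 g n + cauchy_prod f2 g n.
Proof.
by rewrite /cauchy_prod -big_split /=; apply: eq_bigr => i _; rewrite mulrDl.
Qed.

(** Coefficientwise form of [(d + u) * (u + d)^-(p+1) = (u + d)^-p]; it is Pascal's rule. *)
Lemma inv_pow_coef_rec p d i : d != 0 ->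
  d * al p.+1 d i + delay (al p.+1 d) i = al p d i.
Proof.
move=> d0; case: i => [|i] /=; rewrite /al.
  by rewrite !addn0 !bin0 addr0 exprS invfM !mul1r mulrA divff // mul1r.
rewrite !addSn !addnS /= binS natrD !exprS.
rewrite !invfM !mulrA; field.
by rewrite d0 expf_neq0.
Qed.

Lemma cauchy_prod_inv_pow_coef_rec p d g i : d != 0 ->
  d * cauchy_prod (al p.+1 d) g i + delay (cauchy_prod (al p.+1 d) g) i = cauchy_prod (al p d) g i.
Proof.
move=> d0; rewrite -cauchy_prod_delayl /cauchy_prod mulr_sumr -big_split /=.
by apply: eq_bigr => j _; rewrite mulrA -mulrDl inv_pow_coef_rec.
Qed.

Lemma inv_pow_coef0 d i : al 0 d i = (i == 0)%:R.
Proof.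
rewrite /al; case: i => [|i]; first by rewrite bin0 expr0 invr1 !mulr1.
by rewrite bin_small //= mulr0 mul0r.
Qed.

Lemma cauchy_prod_inv_pow_coef0 d g : cauchy_prod (al 0 d) g = g.
Proof.
apply/funext => n; rewrite /cauchy_prod big_nat_recl // inv_pow_coef0 subn0 mul1r.
by rewrite big1_seq ?addr0 // => i _; rewrite inv_pow_coef0 mul0r.
Qed.

(** Both sides satisfy the recursion of [inv_pow_coef_rec], which determines the coefficients degree
    by degree because [d] is invertible. *)
Lemma inv_pow_coefD p q d : d != 0 ->
  cauchy_prod (al p d) (al q d) = al (p + q) d.
Proof.
move=> d0; elim: p => [|p IH]; first exact: cauchy_prod_inv_pow_coef0.
apply/funext => n; elim: n => [|n IHn]; apply: (mulfI d0).
  by have := @cauchy_prod_inv_pow_coef_rec p d (al q d) 0 d0;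
     have := @inv_pow_coef_rec (p + q) d 0 d0; rewrite IH /= !addr0 => -> ->.
have := @cauchy_prod_inv_pow_coef_rec p d (al q d) n.+1 d0.
rewrite IH -(@inv_pow_coef_rec (p + q) d n.+1 d0) /= IHn.
by move/addIr.
Qed.

Lemma principal_part0 u c : pp u c 0 = 0.
Proof. by rewrite /pp big_geq. Qed.

Lemma principal_part_coef0 u d p : (0 < p)%N -> pp u (al 0 d) p = u ^- p.
Proof.
case: p => // p _; rewrite /pp big_nat_recl // inv_pow_coef0 subn0 mul1r.
by rewrite big1_seq ?addr0 // => i _; rewrite inv_pow_coef0 mul0r.
Qed.

(** Write [d = (u + d) - u]: the factor [u + d] turns [c] into [c'], and the factor [u] lowers the
    order of the pole by one. *)
Lemma principal_part_rec u c c' d p :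
    (forall i, d * c i + delay c i = c' i) ->
  d * pp u c p.+1 = pp u c' p.+1 - pp u c p.
Proof.
move=> H; apply/eqP; rewrite eq_sym subr_eq; apply/eqP.
have -> : pp u c p = pp u (delay c) p.+1.
  by rewrite /pp [RHS]big_nat_recl //= mul0r add0r.
rewrite /pp mulr_sumr -big_split /=.
by apply: eq_bigr => i _; rewrite mulrA -mulrDl H.
Qed.

Lemma principal_part_sum (I : Type) (s : seq I) (P : pred I) u
    (c : I -> nat -> F) p :
  pp u (fun i => \sum_(k <- s | P k) c k i) p
  = \sum_(k <- s | P k) pp u (c k) p.
Proof.
rewrite /pp exchange_big /=; apply: eq_bigr => i _.
by rewrite mulr_suml.
Qed.

Lemma principal_partD u f g p :
  pp u (fun i => f i + g i) p = pp u f p + pp u g p.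
Proof.
by rewrite /pp -big_split /=; apply: eq_bigr => i _; rewrite mulrDl.
Qed.

(** With [u = k + w] and [v = j + w] the difference [v - u] is a constant, and
    [v^-q = (u + (v - u))^-q] is expanded in [u]; thus field elements replace formal rational
    functions. Multiplying by [v - u] lowers [p] or [q], whence the double induction. For
    [p = q = 0] the left side is 1 and does not vanish at infinity, which [0 < p + q] excludes. *)
Lemma two_pole_partial_fractions u v p q :
    u != 0 -> v != 0 -> u != v -> (0 < p + q)%N ->
  u ^- p * v ^- q = pp u (al q (v - u)) p + pp v (al p (u - v)) q.
Proof.
move=> u0 v0 uv; have uv0 : u - v != 0 by rewrite subr_eq0.
have vu0 : v - u != 0 by rewrite subr_eq0 eq_sym.
elim: p q => [q|p IHp q].
  by move=> q0; rewrite principal_part0 principal_part_coef0 // expr0 invr1 mul1r add0r.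
elim: q p IHp => [p _ _|q IHq p IHp _].
  by rewrite principal_part0 principal_part_coef0 // expr0 invr1 mulr1 addr0.
apply: (mulfI vu0); rewrite mulrDr.
rewrite (@principal_part_rec _ _ (al q (v - u))); last first.
  by move=> i; rewrite inv_pow_coef_rec.
rewrite -(opprB u v) (mulNr (u - v) (pp v _ _)).
rewrite (@principal_part_rec v _ (al p (u - v))); last first.
  by move=> i; rewrite inv_pow_coef_rec.
have H1 := IHp q.+1; rewrite addnS in H1; move/(_ isT) in H1.
have H2 := IHq p IHp isT.
transitivity (u ^- p.+1 * v ^- q - u ^- p * v ^- q.+1).
  by rewrite !exprS; field; rewrite u0 v0 !expf_neq0.
rewrite H1 H2 opprB; ring.
Qed.

Lemma three_pole_partial_fractions u v w p q r :
    u != 0 -> v != 0 -> w != 0 -> u != v -> u != w -> v != w -> (0 < r)%N ->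
  u ^- p * v ^- q * w ^- r =
    pp u (cauchy_prod (al q (v - u)) (al r (w - u))) p
    + pp v (cauchy_prod (al p (u - v)) (al r (w - v))) q
    + pp w (cauchy_prod (al p (u - w)) (al q (v - w))) r.
Proof.
move=> u0 v0 w0 uv uw vw r0; have uv0 : u - v != 0 by rewrite subr_eq0.
have vu0 : v - u != 0 by rewrite subr_eq0 eq_sym.
have uw0 : u - w != 0 by rewrite subr_eq0.
have vw0 : v - w != 0 by rewrite subr_eq0.
elim: p q => [q|p IHp q].
  rewrite principal_part0 !cauchy_prod_inv_pow_coef0 expr0 invr1 mul1r add0r.
  by rewrite two_pole_partial_fractions // addn_gt0 r0 orbT.
elim: q p IHp => [p _|q IHq p IHp].
  rewrite principal_part0 cauchy_prod_inv_pow_coef0 (cauchy_prodC _ (al 0 _)) cauchy_prod_inv_pow_coef0.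
  rewrite expr0 invr1 mulr1 addr0.
  by rewrite two_pole_partial_fractions.
apply: (mulfI vu0); rewrite !mulrDr.
rewrite (@principal_part_rec _ _ (cauchy_prod (al q (v - u)) (al r (w - u)))); last first.
  by move=> i; rewrite cauchy_prod_inv_pow_coef_rec.
rewrite -(opprB u v) (mulNr (u - v) (pp v _ _)).
rewrite (@principal_part_rec v _ (cauchy_prod (al p (u - v)) (al r (w - v)))); last first.
  by move=> i; rewrite cauchy_prod_inv_pow_coef_rec.
rewrite !(opprB u v).
(* Here [v - u = (v - w) - (u - w)]: one recursion lowers [q], the other lowers [p], and the delayed
   terms cancel. *)
have -> : (v - u) * pp w (cauchy_prod (al p.+1 (u - w)) (al q.+1 (v - w))) r =
    pp w (cauchy_prod (al p.+1 (u - w)) (al q (v - w))) r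
    - pp w (cauchy_prod (al p (u - w)) (al q.+1 (v - w))) r.
  rewrite /pp mulr_sumr -sumrB; apply: eq_bigr => i _; rewrite mulrA -mulrBl.
  congr (_ * _).
  have := @cauchy_prod_inv_pow_coef_rec q (v - w) (al p.+1 (u - w)) i vw0.
  have := @cauchy_prod_inv_pow_coef_rec p (u - w) (al q.+1 (v - w)) i uw0.
  rewrite !(cauchy_prodC (al _ (v - w))) => <- <-; ring.
have H1 := IHp q.+1; have H2 := IHq p IHp.
transitivity (u ^- p.+1 * v ^- q * w ^- r - u ^- p * v ^- q.+1 * w ^- r).
  by rewrite !exprS; field; rewrite u0 v0 !expf_neq0.
rewrite H1 H2; ring.
Qed.

End PartialFractions.

(** * Partial fractions of the truncated product, collected by pole *)

Section ProductDecomposition.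
Variable F : numFieldType.
Implicit Types (c f g : nat -> F) (u v w d : F) (p q r n i N : nat).

Local Notation al := (@inv_pow_coef F).
Local Notation pp := (@principal_part F).
Local Notation cauchy_prod := (@cauchy_prod F).

(* Taylor coefficients, at the pole -n, of the sum of (k + w) ^- p over
   0 <= k <= N with k != n. *)
Definition regular_coef p N n i : F :=
  \sum_(0 <= k < N.+1 | k != n) al p (k%:R - n%:R) i.

Lemma regular_coefE p N n i : (0 < n)%N ->
  regular_coef p N n i =
    al p (- n%:R) i + \sum_(1 <= k < N.+1 | k != n) al p (k%:R - n%:R) i.
Proof.
move=> n0; rewrite /regular_coef big_ltn_cond // eq_sym -lt0n n0.
by rewrite sub0r.
Qed.

Lemma regular_coef0 p N i :
  regular_coef p N 0 i = \sum_(1 <= k < N.+1) al p k%:R i.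
Proof.
rewrite /regular_coef big_ltn_cond //= [LHS]big_nat_cond [RHS]big_nat_cond.
apply: eq_big => [k|k _]; last by rewrite subr0.
by rewrite andbT -lt0n; case: (ltnP 0 k) => //=; rewrite andbT.
Qed.

Lemma off_diagonal_partial_fractions w p1 p2 q k j :
    (0 < q)%N -> (0 < k)%N -> (0 < j)%N -> j != k ->
    (forall n : nat, n%:R + w != 0) ->
  (k%:R + w) ^- p1 * (j%:R + w) ^- p2 * w ^- q =
    pp (k%:R + w) (cauchy_prod (al p2 (j%:R - k%:R)) (al q (- k%:R))) p1
    + pp (j%:R + w) (cauchy_prod (al p1 (k%:R - j%:R)) (al q (- j%:R))) p2
    + pp w (cauchy_prod (al p1 k%:R) (al p2 j%:R)) q.
Proof.
move=> q0 k0 j0 jk w0; have w00 := w0 0; rewrite add0r in w00.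
have nz n : (0 < n)%N -> n%:R + w != w.
  by move=> n0; rewrite -subr_eq0 addrK pnatr_eq0 -lt0n.
rewrite (@three_pole_partial_fractions _ (k%:R + w) (j%:R + w) w) ?nz //.
  have E a b : a + w - (b + w) = a - b by ring.
  have E0 a : w - (a + w) = - a by ring.
  by rewrite !E !E0 !addrK.
by rewrite (inj_eq (addIr w)) eqr_nat eq_sym.
Qed.

Lemma diagonal_partial_fractions w p1 p2 q n :
    (0 < q)%N -> (0 < n)%N -> (forall n : nat, n%:R + w != 0) ->
  (n%:R + w) ^- p1 * (n%:R + w) ^- p2 * w ^- q =
    pp (n%:R + w) (al q (- n%:R)) (p1 + p2)
    + pp w (cauchy_prod (al p1 n%:R) (al p2 n%:R)) q.
Proof.
move=> q0 n0 w0; have w00 := w0 0; rewrite add0r in w00.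
rewrite -invfM -exprD two_pole_partial_fractions //; last first.
- by rewrite addn_gt0 q0 orbT.
- by rewrite -subr_eq0 addrK pnatr_eq0 -lt0n.
rewrite addrK opprD addrCA subrr addr0 inv_pow_coefD //.
by rewrite pnatr_eq0 -lt0n.
Qed.

Lemma origin_partial_fractions w p1 p2 q n :
    (0 < q)%N -> (0 < n)%N -> (forall n : nat, n%:R + w != 0) ->
  w ^- p1 * (n%:R + w) ^- p2 * w ^- q =
    pp (n%:R + w) (cauchy_prod (al p1 (- n%:R)) (al q (- n%:R))) p2
    + pp w (al p2 n%:R) (p1 + q).
Proof.
move=> q0 n0 w0; have w00 := w0 0; rewrite add0r in w00.
rewrite mulrAC -invfM -exprD mulrC two_pole_partial_fractions //; last first.
- by rewrite !addn_gt0 q0 !orbT.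
- by rewrite -subr_eq0 addrK pnatr_eq0 -lt0n.
rewrite addrK opprD addrCA subrr addr0 inv_pow_coefD //.
by rewrite oppr_eq0 pnatr_eq0 -lt0n.
Qed.

(** Each pair [(k, j)] has its own expansion: both indices zero, exactly one zero, equal, or
    distinct and positive. An index 0 merges with [w^-q], hence the orders [p1 + q] and [p2 + q] at
    the pole 0; equal indices give the order [p1 + p2] at [-n]. The [k = 0] term of [regular_coef]
    at [-n] comes from the pairs with one index zero. *)
Lemma product_partial_fractions w p1 p2 q N :
    (0 < q)%N -> (forall n : nat, n%:R + w != 0) ->
  (\sum_(0 <= k < N.+1) (k%:R + w) ^- p1)
    * (\sum_(0 <= j < N.+1) (j%:R + w) ^- p2) * w ^- q =
    w ^- (p1 + p2 + q)
    + pp w (regular_coef p2 N 0) (p1 + q) + pp w (regular_coef p1 N 0) (p2 + q)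
    + pp w (cauchy_prod (regular_coef p1 N 0) (regular_coef p2 N 0)) q
    + \sum_(1 <= n < N.+1)
       (pp (n%:R + w) (al q (- n%:R)) (p1 + p2)
        + pp (n%:R + w) (cauchy_prod (regular_coef p1 N n) (al q (- n%:R))) p2
        + pp (n%:R + w) (cauchy_prod (regular_coef p2 N n) (al q (- n%:R))) p1).
Proof.
move=> q0 w0.
have reg0 p : regular_coef p N 0 = fun i => \sum_(1 <= k < N.+1) al p k%:R i.
  by apply/funext => i; rewrite regular_coef0.
have regE p n : (0 < n)%N -> regular_coef p N n = fun i =>
    al p (- n%:R) i + \sum_(1 <= k < N.+1 | k != n) al p (k%:R - n%:R) i.
  by move=> n0; apply/funext => i; rewrite regular_coefE.
have pp_reg p r n : (0 < n)%N ->
    pp (n%:R + w) (cauchy_prod (regular_coef p N n) (al q (- n%:R))) r =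
    pp (n%:R + w) (cauchy_prod (al p (- n%:R)) (al q (- n%:R))) r
    + \sum_(1 <= k < N.+1 | k != n)
        pp (n%:R + w) (cauchy_prod (al p (k%:R - n%:R)) (al q (- n%:R))) r.
  move=> n0; rewrite regE // -principal_part_sum -principal_partD.
  congr (pp _ _ _); apply/funext => i.
  by rewrite cauchy_prodDl cauchy_prod_suml.
have conv00 : pp w (cauchy_prod (regular_coef p1 N 0) (regular_coef p2 N 0)) q =
    \sum_(1 <= k < N.+1) \sum_(1 <= j < N.+1)
      pp w (cauchy_prod (al p1 k%:R) (al p2 j%:R)) q.
  rewrite !reg0; under eq_bigr do rewrite -principal_part_sum.
  rewrite -principal_part_sum; congr (pp _ _ _); apply/funext => i.
  by rewrite cauchy_prod_suml; apply: eq_bigr => k _; rewrite cauchy_prod_sumr.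
set off := \sum_(1 <= k < N.+1) \sum_(1 <= j < N.+1)
  (k%:R + w) ^- p1 * (j%:R + w) ^- p2 * w ^- q.
have offE : off =
    \sum_(1 <= n < N.+1) pp (n%:R + w) (al q (- n%:R)) (p1 + p2)
    + \sum_(1 <= n < N.+1) \sum_(1 <= k < N.+1 | k != n)
        pp (n%:R + w) (cauchy_prod (al p1 (k%:R - n%:R)) (al q (- n%:R))) p2
    + \sum_(1 <= n < N.+1) \sum_(1 <= k < N.+1 | k != n)
        pp (n%:R + w) (cauchy_prod (al p2 (k%:R - n%:R)) (al q (- n%:R))) p1
    + \sum_(1 <= k < N.+1) \sum_(1 <= j < N.+1)
        pp w (cauchy_prod (al p1 k%:R) (al p2 j%:R)) q.
  (* Exchanging the sums makes the index of the [p1] factor the outer one, so that the claim can be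
     checked for each fixed [k]. *)
  have -> : \sum_(1 <= n < N.+1) \sum_(1 <= k < N.+1 | k != n)
        pp (n%:R + w) (cauchy_prod (al p1 (k%:R - n%:R)) (al q (- n%:R))) p2 =
      \sum_(1 <= k < N.+1) \sum_(1 <= n < N.+1 | n != k)
        pp (n%:R + w) (cauchy_prod (al p1 (k%:R - n%:R)) (al q (- n%:R))) p2.
    rewrite (exchange_big_dep xpredT) //=; apply: eq_bigr => k _.
    by apply: eq_bigl => n; rewrite eq_sym.
  rewrite -!big_split /=; rewrite /off; apply: eq_big_nat => k /andP[k0 kN].
  have kin : k \in index_iota 1 N.+1 by rewrite mem_index_iota k0.
  rewrite (bigD1_seq k) ?iota_uniq //= [X in _ = _ + X](bigD1_seq k) ?iota_uniq //=.
  rewrite diagonal_partial_fractions // -!addrA; congr (_ + _).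
  have -> : \sum_(1 <= j < N.+1 | j != k)
      (k%:R + w) ^- p1 * (j%:R + w) ^- p2 * w ^- q =
      \sum_(1 <= j < N.+1 | j != k)
        pp (k%:R + w) (cauchy_prod (al p2 (j%:R - k%:R)) (al q (- k%:R))) p1
      + \sum_(1 <= j < N.+1 | j != k)
        pp (j%:R + w) (cauchy_prod (al p1 (k%:R - j%:R)) (al q (- j%:R))) p2
      + \sum_(1 <= j < N.+1 | j != k) pp w (cauchy_prod (al p1 k%:R) (al p2 j%:R)) q.
    rewrite -!big_split /= big_nat_cond [RHS]big_nat_cond.
    apply: eq_bigr => j /andP[/andP[j0 jN] jk].
    by rewrite off_diagonal_partial_fractions.
  ring.
have -> : (\sum_(0 <= k < N.+1) (k%:R + w) ^- p1)
    * (\sum_(0 <= j < N.+1) (j%:R + w) ^- p2) * w ^- q =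
    w ^- (p1 + p2 + q)
    + \sum_(1 <= n < N.+1) w ^- p1 * (n%:R + w) ^- p2 * w ^- q
    + \sum_(1 <= n < N.+1) w ^- p2 * (n%:R + w) ^- p1 * w ^- q + off.
  rewrite big_ltn // [in X in _ * X * _]big_ltn // !add0r.
  rewrite !mulrDl !mulrDr !mulrDl !exprD !invfM -!addrA; congr (_ + _).
  rewrite mulr_sumr mulr_suml; congr (_ + _).
  congr (_ + _).
    by rewrite -!mulr_suml -mulr_sumr mulrAC mulrC [in RHS]mulrC; ring.
  rewrite /off mulr_suml mulr_suml; apply: eq_bigr => k _.
  by rewrite mulr_sumr mulr_suml.
have org r s : \sum_(1 <= n < N.+1) w ^- r * (n%:R + w) ^- s * w ^- q =
    \sum_(1 <= n < N.+1)
      pp (n%:R + w) (cauchy_prod (al r (- n%:R)) (al q (- n%:R))) s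
    + pp w (regular_coef s N 0) (r + q).
  rewrite reg0 principal_part_sum -big_split /=.
  by apply: eq_big_nat => n /andP[n0 _]; rewrite origin_partial_fractions.
rewrite !org offE conv00.
have -> : \sum_(1 <= n < N.+1)
       (pp (n%:R + w) (al q (- n%:R)) (p1 + p2)
        + pp (n%:R + w) (cauchy_prod (regular_coef p1 N n) (al q (- n%:R))) p2
        + pp (n%:R + w) (cauchy_prod (regular_coef p2 N n) (al q (- n%:R))) p1) =
    \sum_(1 <= n < N.+1) pp (n%:R + w) (al q (- n%:R)) (p1 + p2)
    + (\sum_(1 <= n < N.+1)
         pp (n%:R + w) (cauchy_prod (al p1 (- n%:R)) (al q (- n%:R))) p2
       + \sum_(1 <= n < N.+1) \sum_(1 <= k < N.+1 | k != n)
        pp (n%:R + w) (cauchy_prod (al p1 (k%:R - n%:R)) (al q (- n%:R))) p2)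
    + (\sum_(1 <= n < N.+1)
         pp (n%:R + w) (cauchy_prod (al p2 (- n%:R)) (al q (- n%:R))) p1
       + \sum_(1 <= n < N.+1) \sum_(1 <= k < N.+1 | k != n)
        pp (n%:R + w) (cauchy_prod (al p2 (k%:R - n%:R)) (al q (- n%:R))) p1).
  rewrite -!big_split /=; apply: eq_big_nat => n /andP[n0 _].
  by rewrite !pp_reg.
ring.
Qed.

End ProductDecomposition.

(** * Limits *)

Section Limits.
Variable R : realType.
Implicit Types (u v b P : R^nat) (a l : R) (m n s N M : nat).

Lemma cvg_sum_nat (f : nat -> R^nat) (l : nat -> R) m n :
    (forall i, (m <= i < n)%N -> f i @ \oo --> l i) ->
  (fun N => \sum_(m <= i < n) f i N) @ \oo --> \sum_(m <= i < n) l i.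
Proof.
move=> fl; rewrite big_nat_cond.
under eq_fun do rewrite big_nat_cond.
apply: (@cvg_big R^o); first exact: add_continuous.
by move=> i /andP[mn _]; exact: fl.
Qed.

Lemma cvg_cst_of_bound u l K :
  (forall n, (K <= n)%N -> u n = l) -> u @ \oo --> l.
Proof. by move=> ul; apply: cvg_near_cst; exists K => // n /= /ul. Qed.

Lemma tannery (u : nat -> R^nat) v b P (S : R) :
    (forall N, series (u N) @ \oo --> P N) -> (forall m, u ^~ m @ \oo --> v m) ->
    (forall N m, `|u N m| <= b m) -> cvgn (series b) -> series v @ \oo --> S ->
  P @ \oo --> S.
Proof.
move=> uP uv ub bcv vS.
have b0 m : 0 <= b m by apply: le_trans (ub 0 m).
have vb m : `|v m| <= b m.
  apply: cvgr_to_le (cvg_norm (uv m)) _.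
  by apply: nearW => N; exact: ub.
pose B := limn (series b).
(* Used both for [v] and for every row [u N]; the bound does not depend on the row, so one [K]
   serves all of them. *)
have tail w l K : series w @ \oo --> l -> (forall m, `|w m| <= b m) ->
    `|l - series w K| <= B - series b K.
  move=> wl wb.
  have wlK : (fun L => series w L - series w K) @ \oo --> l - series w K.
    by apply: cvgB => //; exact: cvg_cst.
  apply: cvgr_to_le (cvg_norm wlK) _.
  exists K => // L /= KL.
  rewrite sub_series_geq //; apply: le_trans (ler_norm_sum _ _ _) _.
  apply: (@le_trans _ _ (series b L - series b K)).
    by rewrite sub_series_geq //; apply: ler_sum => i _; exact: wb.
  rewrite lerD2r; apply: nondecreasing_cvgn_le => //.
  by apply: nondecreasing_series => i _ _; exact: b0.
apply/cvgrPdist_le => e e0.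
have e3 : 0 < e / 3 by rewrite divr_gt0.
have [K _ /(_ K (leqnn K)) /= HK] : \forall K \near \oo, `|B - series b K| <= e / 3.
  by move/cvgrPdist_le : bcv; exact.
have uvK : (fun N => series (u N) K) @ \oo --> series v K.
  by apply: cvg_sum_nat => i _; exact: uv.
have : \forall N \near \oo, `|series v K - series (u N) K| <= e / 3.
  by move/cvgrPdist_le : uvK; exact.
apply: filterS => N /= HN.
have H1 := tail _ _ K vS vb; have H2 := tail _ _ K (uP N) (ub N).
have HB : B - series b K <= e / 3 by apply: le_trans HK; exact: ler_norm.
have -> : S - P N = (S - series v K) + (series v K - series (u N) K)
                    - (P N - series (u N) K) by ring.
apply: le_trans (ler_normB _ _) _.
have := ler_normD (S - series v K) (series v K - series (u N) K).
lra.
Qed.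

Lemma cvg_series_dominated u b :
  (forall m, `|u m| <= b m) -> cvgn (series b) -> cvgn (series u).
Proof.
move=> ub bcv; apply: normed_cvg; apply: (@series_le_cvg _ _ b) => // n.
  exact: normr_ge0.
exact: le_trans (normr_ge0 _) (ub n).
Qed.

Definition shifted_harm a s n : R := \sum_(1 <= k < n.+1) (k%:R - a) ^- s.

Lemma shifted_harmE a s :
  shifted_harm a s = series (fun k => (k.+1%:R - a) ^- s).
Proof. by apply/funext => n; rewrite /shifted_harm big_add1. Qed.

Lemma hharmE s : hharm R s = shifted_harm 2^-1 s.
Proof. by []. Qed.

Lemma harmE s : harm R s = shifted_harm 0 s.
Proof.
by apply/funext => n; apply: eq_bigr => k _; rewrite subr0.
Qed.

Lemma shifted_harm_nested a s n : shifted_harm a s n = nested_sum a [:: s] n.+1.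
Proof. by apply: eq_bigr => k _; rewrite /= mulr1. Qed.

Lemma inv_sqr_sum_ub n : \sum_(0 <= k < n) (k.+1%:R : R) ^- 2 <= 2.
Proof.
(* The term [- m.+1%:R^-1] makes the induction telescope. *)
suff H m : \sum_(0 <= k < m.+1) (k.+1%:R : R) ^- 2 <= 2 - m.+1%:R^-1.
  case: n => [|n]; first by rewrite big_geq.
  by apply: le_trans (H n) _; rewrite gerBl invr_ge0.
elim: m => [|m IH]; first by rewrite big_nat1 expr1n invr1; lra.
rewrite big_nat_recr //=; apply: le_trans (lerD IH (lexx _)) _.
rewrite -subr_ge0.
have m0 : 0 < m.+1%:R :> R by [].
have m1 : 0 < m.+2%:R :> R by [].
rewrite -[m.+2%:R]natr1; set x := m.+1%:R in m0 *.
have -> : 2 - (x + 1)^-1 - (2 - x^-1 + (x + 1) ^- 2) = (x * (x + 1) ^+ 2)^-1.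
  by field; rewrite !gt_eqF // addr_gt0.
by rewrite invr_ge0 mulr_ge0 ?sqr_ge0 // ltW.
Qed.

Lemma shifted_gt0 a n : a <= 2^-1 -> 0 < n.+1%:R - a.
Proof.
move=> ha; have : 1 <= n.+1%:R :> R by rewrite ler1n.
by have := ha; lra.
Qed.

Lemma cvg_shifted_harm a s : a <= 2^-1 -> (1 < s)%N -> cvgn (shifted_harm a s).
Proof.
move=> ha s1; rewrite shifted_harmE.
have pos n := @shifted_gt0 a n ha.
(* Since [a <= 2^-1], [n.+1%:R - a] is at least [n.+1%:R / 2], which costs the factor [2 ^+ s]; the
   exponent [s] is then lowered to 2. *)
apply: (@series_le_cvg _ _ (fun k => 2 ^+ s * k.+1%:R ^- 2)) => [n|n|n|].
- by rewrite invr_ge0 exprn_ge0 // ltW.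
- by rewrite mulr_ge0.
- have h : n.+1%:R / 2 <= n.+1%:R - a.
    have : 1 <= n.+1%:R :> R by rewrite ler1n.
    have := ha; lra.
  apply: (@le_trans _ _ ((n.+1%:R / 2) ^- s)).
    rewrite lef_pV2 ?posrE ?exprn_gt0 ?divr_gt0 //.
    by rewrite lerXn2r // nnegrE ltW ?divr_gt0.
  rewrite expr_div_n invf_div ler_wpM2l //.
  rewrite lef_pV2 ?posrE ?exprn_gt0 // ler_weXn2l // ler1n //.
apply: nondecreasing_is_cvgn.
  by apply: nondecreasing_series => i _ _; rewrite mulr_ge0.
exists (2 ^+ s * 2) => _ [n _ <-]; rewrite /series /= -mulr_sumr.
by rewrite ler_wpM2l // inv_sqr_sum_ub.
Qed.

Lemma shifted_harm_ge0 a s n : a <= 2^-1 -> 0 <= shifted_harm a s n.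
Proof.
move=> ha; rewrite shifted_harmE; apply: sumr_ge0 => i _.
by rewrite invr_ge0 exprn_ge0 // ltW // shifted_gt0.
Qed.

Lemma shifted_harm_le_lim a s n : a <= 2^-1 -> (1 < s)%N ->
  shifted_harm a s n <= limn (shifted_harm a s).
Proof.
move=> ha s1; apply: nondecreasing_cvgn_le; last exact: cvg_shifted_harm.
rewrite shifted_harmE; apply: nondecreasing_series => i _ _.
by rewrite invr_ge0 exprn_ge0 // ltW // shifted_gt0.
Qed.

(** [nested_sum] stops strictly below its bound and [shifted_harm] includes it, so the two sequences
    differ by a shift, which leaves the limit unchanged. *)
Lemma cvg_nested_sum1 a s : a <= 2^-1 -> (1 < s)%N ->
  shifted_harm a s @ \oo --> limn (nested_sum a [:: s]).
Proof.
move=> ha s1; have := cvg_shifted_harm _ _ ha s1.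
have -> : shifted_harm a s = (fun n => nested_sum a [:: s] n.+1).
  by apply/funext => n; exact: shifted_harm_nested.
move=> /cvg_ex[l hl]; move: (hl); rewrite cvg_shiftS => hl'.
by rewrite (cvg_lim _ hl').
Qed.

Lemma cvg_hharm s : (1 < s)%N -> hharm R s @ \oo --> ttilde R [:: s].
Proof. by move=> s1; exact: cvg_nested_sum1. Qed.

Lemma cvg_harm s : (1 < s)%N -> harm R s @ \oo --> zeta R [:: s].
Proof.
by move=> s1; rewrite harmE; apply: cvg_nested_sum1; rewrite // invr_ge0.
Qed.

Lemma hharm_ge0 s n : 0 <= hharm R s n.
Proof. exact: shifted_harm_ge0. Qed.

Lemma harm_ge0 s n : 0 <= harm R s n.
Proof. by rewrite harmE shifted_harm_ge0 // invr_ge0. Qed.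

Lemma hharm_le s n : (1 < s)%N -> hharm R s n <= ttilde R [:: s].
Proof.
move=> s1; rewrite -(cvg_lim _ (cvg_hharm s s1)) //.
exact: shifted_harm_le_lim.
Qed.

Lemma harm_le s n : (1 < s)%N -> harm R s n <= zeta R [:: s].
Proof.
move=> s1; rewrite -(cvg_lim _ (cvg_harm s s1)) // harmE.
by apply: shifted_harm_le_lim => //; rewrite invr_ge0.
Qed.

End Limits.

(** * Symmetric summation over the half-integers *)

Section HalfIntegerSums.
Variable R : realType.
Implicit Types (G : R -> R) (c : nat -> R) (a l : R) (m n p q s N M : nat).

Local Notation half m := (m%:R - 2^-1 : R).
Local Notation al := (@inv_pow_coef R).
Local Notation pp := (@principal_part R).

Definition half_sum G : R^nat :=
  series (fun m => G (half m.+1) + G (- half m.+1)).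

Lemma half_sumS G M :
  half_sum G M.+1 = half_sum G M + (G (half M.+1) + G (- half M.+1)).
Proof. by rewrite /half_sum seriesSr. Qed.

(* For l = 1 the factor vanishes and the junk value ttilde [:: 1] is harmless. *)
Definition half_zeta (l : nat) : R := (1 + (-1) ^+ l) * ttilde R [:: l].

Definition principal_part_sum_value c p : R :=
  \sum_(0 <= i < p) c i * half_zeta (p - i).

Lemma cvg_half_sumD G1 G2 l1 l2 :
    half_sum G1 @ \oo --> l1 -> half_sum G2 @ \oo --> l2 ->
  half_sum (fun w => G1 w + G2 w) @ \oo --> l1 + l2.
Proof.
move=> h1 h2; have -> : half_sum (fun w => G1 w + G2 w) =
    fun M => half_sum G1 M + half_sum G2 M.
  apply/funext => M; rewrite /half_sum /series /= -big_split /=.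
  by apply: eq_bigr => i _; ring.
exact: cvgD.
Qed.

Lemma cvg_half_sumM a G l :
  half_sum G @ \oo --> l -> half_sum (fun w => a * G w) @ \oo --> a * l.
Proof.
move=> h; have -> : half_sum (fun w => a * G w) = fun M => a * half_sum G M.
  apply/funext => M; rewrite /half_sum /series /= mulr_sumr.
  by apply: eq_bigr => i _; ring.
exact: cvgMl_tmp.
Qed.

Lemma cvg_half_sum_big (G : nat -> R -> R) (l : nat -> R) m n :
    (forall i, (m <= i < n)%N -> half_sum (G i) @ \oo --> l i) ->
  half_sum (fun w => \sum_(m <= i < n) G i w) @ \oo --> \sum_(m <= i < n) l i.
Proof.
move=> h; have -> : half_sum (fun w => \sum_(m <= i < n) G i w) =
    fun M => \sum_(m <= i < n) half_sum (G i) M.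
  apply/funext => M; rewrite /half_sum /series /= exchange_big /=.
  by apply: eq_bigr => i _; rewrite big_split.
exact: cvg_sum_nat.
Qed.

Lemma cvg_inv_pow_shift a (l : nat) : (0 < l)%N ->
  (fun M => (M%:R + a) ^- l) @ \oo --> (0 : R).
Proof.
case: l => // l _; apply/cvgrPdist_le => e e0.
(* For [M >= K] the number [M + a] exceeds both 1 and [e^-1], hence so does each of its positive
   powers exceed [e^-1]. *)
pose K := Num.bound (`|a| + 1 + e^-1); exists K => // M /= KM.
have hM : `|a| + 1 + e^-1 <= M%:R.
  apply: le_trans (ltW (archi_boundP _)) _; last by rewrite ler_nat.
  by rewrite !addr_ge0 // invr_ge0 ltW.
have ha : - a <= `|a| by rewrite -normrN ler_norm.
have ei : 0 < e^-1 by rewrite invr_gt0.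
have h1 : 1 <= M%:R + a by lra.
have h2 : e^-1 <= M%:R + a by lra.
have h0 : 0 < M%:R + a by lra.
rewrite sub0r normrN ger0_norm ?invr_ge0 ?exprn_ge0 ?(ltW h0) //.
rewrite -[leRHS]invrK lef_pV2 ?posrE ?exprn_gt0 //.
by apply: le_trans h2 _; rewrite exprS ler_peMr ?exprn_ege1 // ltW.
Qed.

Lemma half_int_gt0 m : 0 < half m.+1.
Proof. exact: shifted_gt0. Qed.

(* Shifting a window of half-integers by n changes only n terms at each end. *)
Lemma cvg_half_sum_inv_pow n (l : nat) : (0 < l)%N ->
  half_sum (fun w => (n%:R + w) ^- l) @ \oo --> half_zeta l.
Proof.
move=> l0; elim: n => [|n IH].
  have -> : half_sum (fun w => (0 + w) ^- l) =
      fun M => (1 + (-1) ^+ l) * hharm R l M.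
    apply/funext => M; rewrite /half_sum hharmE shifted_harmE /series /=.
    rewrite mulr_sumr; apply: eq_bigr => i _.
    by rewrite !add0r inv_pow_opp; ring.
  (* For exponent 1 the factor [1 + (-1)] removes the divergent sums [hharm 1 M], and the sequence
     is constantly 0. *)
  case: l l0 => // -[_|l _].
    rewrite /half_zeta; under eq_fun do rewrite expr1 subrr mul0r.
    by rewrite expr1 subrr mul0r; exact: cvg_cst.
  by apply: cvgMl_tmp; exact: cvg_hharm.
(* One more shift brings in the term at [M + n + 1/2] and drops the one at [n + 1/2 - M]; both tend
   to 0 as [M] grows. *)
have -> : half_sum (fun w => (n.+1%:R + w) ^- l) = fun M =>
    half_sum (fun w => (n%:R + w) ^- l) M
    + ((M%:R + (n%:R + 2^-1)) ^- l
       - (-1) ^+ l * (M%:R + - (n%:R + 2^-1)) ^- l).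
  have step a b : (-1) ^+ l * (a - b) ^- l = (b - a) ^- l :> R.
    by rewrite -inv_pow_opp opprB.
  apply/funext => M; elim: M => [|M IHM].
    by rewrite /half_sum /series /= !big_geq // step subr0 !add0r subrr.
  rewrite !half_sumS IHM !step.
  have -> : n%:R + 2^-1 - M%:R = n.+1%:R + - half M.+1 :> R.
    by rewrite -!natr1; field.
  have -> : n%:R + 2^-1 - M.+1%:R = n%:R + - half M.+1 :> R by field.
  have -> : M%:R + (n%:R + 2^-1) = n%:R + half M.+1 :> R.
    by rewrite -!natr1; field.
  have -> : M.+1%:R + (n%:R + 2^-1) = n.+1%:R + half M.+1 :> R.
    by rewrite -!natr1; field.
  ring.
rewrite -[half_zeta l]addr0; apply: cvgD => //.
rewrite -(subr0 0); apply: cvgB; first exact: cvg_inv_pow_shift.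
by rewrite -(mulr0 ((-1) ^+ l)); apply: cvgMl_tmp; exact: cvg_inv_pow_shift.
Qed.

Lemma cvg_half_sum_principal_part n c p :
  half_sum (fun w => pp (n%:R + w) c p) @ \oo
    --> principal_part_sum_value c p.
Proof.
apply: cvg_half_sum_big => i /andP[_ ip].
by apply: cvg_half_sumM; apply: cvg_half_sum_inv_pow; rewrite subn_gt0.
Qed.

(** No half-integer is a pole: an equality would identify an odd number with an even one. *)
Lemma half_neq0 m n : n%:R + half m.+1 != 0 /\ n%:R - half m.+1 != 0.
Proof.
split.
  by rewrite gt_eqF // ltr_wpDl // half_int_gt0.
apply/eqP => h; have : ((2 * n).+1%:R : R) = (2 * m.+1)%:R.
  by rewrite -natr1 !natrM; lra.
by move/eqP; rewrite eqr_nat => /eqP; lia.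
Qed.

Definition truncated_product p1 p2 q N (w : R) : R :=
  (\sum_(0 <= k < N.+1) (k%:R + w) ^- p1)
    * (\sum_(0 <= j < N.+1) (j%:R + w) ^- p2) * w ^- q.

Definition truncated_pole_sum p1 p2 q N : R :=
  half_zeta (p1 + p2 + q)
  + principal_part_sum_value (regular_coef R p2 N 0) (p1 + q)
  + principal_part_sum_value (regular_coef R p1 N 0) (p2 + q)
  + principal_part_sum_value
      (cauchy_prod R (regular_coef R p1 N 0) (regular_coef R p2 N 0)) q
  + \sum_(1 <= n < N.+1)
     (principal_part_sum_value (al q (- n%:R)) (p1 + p2)
      + principal_part_sum_value
          (cauchy_prod R (regular_coef R p1 N n) (al q (- n%:R))) p2
      + principal_part_sum_value
          (cauchy_prod R (regular_coef R p2 N n) (al q (- n%:R))) p1).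

Lemma cvg_half_sum_truncated_product p1 p2 q N : (0 < q)%N ->
  half_sum (truncated_product p1 p2 q N) @ \oo
    --> truncated_pole_sum p1 p2 q N.
Proof.
move=> q0.
pose E w := w ^- (p1 + p2 + q)
    + pp w (regular_coef R p2 N 0) (p1 + q) + pp w (regular_coef R p1 N 0) (p2 + q)
    + pp w (cauchy_prod R (regular_coef R p1 N 0) (regular_coef R p2 N 0)) q
    + \sum_(1 <= n < N.+1)
       (pp (n%:R + w) (al q (- n%:R)) (p1 + p2)
        + pp (n%:R + w) (cauchy_prod R (regular_coef R p1 N n) (al q (- n%:R))) p2
        + pp (n%:R + w) (cauchy_prod R (regular_coef R p2 N n) (al q (- n%:R))) p1).
have -> : half_sum (truncated_product p1 p2 q N) = half_sum E.
  apply/funext => M; apply: eq_bigr => m _; rewrite /truncated_product.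
  by rewrite !product_partial_fractions // => n; case: (half_neq0 m n).
have pp0 c p : half_sum (fun w => pp w c p) @ \oo --> principal_part_sum_value c p.
  have := cvg_half_sum_principal_part 0 c p.
  by under [fun w : R => pp (0 + w) c p]eq_fun do rewrite add0r.
apply: cvg_half_sumD; last first.
  apply: cvg_half_sum_big => n _.
  by do 2?apply: cvg_half_sumD; exact: cvg_half_sum_principal_part.
do 3?[apply: cvg_half_sumD => //].
have := cvg_half_sum_inv_pow 0 (p1 + p2 + q).
under [fun w : R => (0 + w) ^- _]eq_fun do rewrite add0r.
by apply; rewrite addn_gt0 q0 orbT.
Qed.

Lemma truncated_sum_pos p N m :
  \sum_(0 <= k < N.+1) (k%:R + half m.+1) ^- p
  = hharm R p (N.+1 + m) - hharm R p m.
Proof.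
elim: N => [|N IH].
  by rewrite big_nat1 add0r /hharm [in RHS]big_nat_recr //= addrAC subrr add0r.
rewrite big_nat_recr //= IH /hharm [in RHS](big_nat_recr (N.+1 + m).+1) //=.
have -> : N.+1%:R + half m.+1 = half (N.+1 + m).+1 :> R.
  by rewrite -!natr1 natrD; ring.
ring.
Qed.

(** The terms with [k > m] are positive half-integers; those with [k <= m] are negative and
    reflected at the cost of [(-1)^p]. Truncated subtraction lets one formula cover both [N <= m]
    and [m <= N]. The index [m.+1], against [m] on the positive side, is the source of the terms of
    [half_integer_total] with raised exponents. *)
Lemma truncated_sum_neg p N m :
  \sum_(0 <= k < N.+1) (k%:R - half m.+1) ^- p
  = hharm R p (N - m) + (-1) ^+ p * (hharm R p m.+1 - hharm R p (m - N)).
Proof.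
have hS n : hharm R p n.+1 = hharm R p n + (half n.+1) ^- p.
  by rewrite /hharm [in LHS]big_nat_recr.
elim: N => [|N IH].
  rewrite big_nat1 add0r inv_pow_opp sub0n subn0 hS.
  by rewrite {1}/hharm big_geq // add0r (addrC (hharm R p m)) addrK.
rewrite big_nat_recr //= IH; case: (leqP m N) => mN.
  rewrite (eqP (_ : m - N == 0)%N) ?subn_eq0 //.
  rewrite (eqP (_ : m - N.+1 == 0)%N) ?subn_eq0 ?leqW // subSn // (hS (N - m)%N).
  have -> : N.+1%:R - half m.+1 = half (N - m).+1 :> R.
    by rewrite -!natr1 natrB //; field.
  ring.
have -> : (m - N)%N = (m - N.+1).+1 by rewrite -subSn.
rewrite (hS (m - N.+1)%N) (eqP (_ : N - m == 0)%N) ?subn_eq0 ?(ltnW mN) //.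
rewrite (eqP (_ : N.+1 - m == 0)%N) ?subn_eq0 //.
have -> : N.+1%:R - half m.+1 = - half (m - N.+1).+1 :> R.
  by rewrite -!natr1 natrB // -natr1; field.
rewrite inv_pow_opp; ring.
Qed.

Lemma truncated_sum_pos_bound p N m : (1 < p)%N ->
  `|\sum_(0 <= k < N.+1) (k%:R + half m.+1) ^- p| <= 2 * ttilde R [:: p].
Proof.
move=> p1; rewrite truncated_sum_pos.
have := hharm_ge0 R p m; have := hharm_le R p m p1.
have := hharm_ge0 R p (N.+1 + m); have := hharm_le R p (N.+1 + m) p1.
by move=> *; rewrite ler_norml; apply/andP; split; lra.
Qed.

Lemma truncated_sum_neg_bound p N m : (1 < p)%N ->
  `|\sum_(0 <= k < N.+1) (k%:R - half m.+1) ^- p| <= 2 * ttilde R [:: p].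
Proof.
move=> p1; rewrite truncated_sum_neg; apply: le_trans (ler_normD _ _) _.
rewrite normrM normrX normrN1 expr1n mul1r.
have := hharm_ge0 R p (N - m); have := hharm_le R p (N - m) p1.
have := hharm_ge0 R p m.+1; have := hharm_le R p m.+1 p1.
have := hharm_ge0 R p (m - N); have := hharm_le R p (m - N) p1.
move=> h1 h2 h3 h4 h5 h6.
have h7 : `|hharm R p m.+1 - hharm R p (m - N)| <= ttilde R [:: p].
  by rewrite ler_norml; apply/andP; split; lra.
rewrite (ger0_norm h6); lra.
Qed.

Lemma cvg_truncated_sum_pos p m : (1 < p)%N ->
  (fun N => \sum_(0 <= k < N.+1) (k%:R + half m.+1) ^- p) @ \oo
    --> ttilde R [:: p] - hharm R p m.
Proof.
move=> p1; under eq_fun do rewrite truncated_sum_pos.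
apply: cvgB; last exact: cvg_cst.
under eq_fun do rewrite addSnnS.
apply: (cvg_comp (fun N => (N + m.+1)%N) (hharm R p)); first exact: cvg_addnr.
exact: cvg_hharm.
Qed.

Lemma cvg_truncated_sum_neg p m : (1 < p)%N ->
  (fun N => \sum_(0 <= k < N.+1) (k%:R - half m.+1) ^- p) @ \oo
    --> ttilde R [:: p] + (-1) ^+ p * hharm R p m.+1.
Proof.
move=> p1; under eq_fun do rewrite truncated_sum_neg.
apply: cvgD.
  apply: (cvg_comp (fun N => (N - m)%N) (hharm R p)); first exact: cvg_subnr.
  exact: cvg_hharm.
apply: (@cvg_cst_of_bound _ _ _ m) => N mN.
rewrite (eqP (_ : m - N == 0)%N) ?subn_eq0 //.
by rewrite {2}/hharm big_geq // subr0.
Qed.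

End HalfIntegerSums.

(** * Limits of the two evaluations as the truncation is removed *)

Section PoleSums.
Variable R : realType.
Implicit Types (m n p q r s i j N M : nat).

Local Notation half m := (m%:R - 2^-1 : R).
Local Notation al := (@inv_pow_coef R).
Local Notation ppv := (principal_part_sum_value R).

Lemma inv_pow_half_ge0 q m : 0 <= (half m.+1) ^- q.
Proof. by rewrite invr_ge0 exprn_ge0 // ltW // half_int_gt0. Qed.

Lemma cvg_series_half q : (1 < q)%N ->
  series (fun m => (half m.+1) ^- q) @ \oo --> ttilde R [:: q].
Proof. by move=> q1; have := cvg_hharm R q q1; rewrite hharmE shifted_harmE. Qed.

Lemma is_cvg_series_bounded_half (f : R^nat) (B : R) q : (1 < q)%N ->
    (forall m, `|f m| <= B) ->
  cvgn (series (fun m => f m / (half m.+1) ^+ q)).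
Proof.
move=> q1 fB; apply: (@cvg_series_dominated _ _ (fun m => B * (half m.+1) ^- q)).
  by move=> m; rewrite normrM (ger0_norm (inv_pow_half_ge0 _ _)) ler_wpM2r
    ?inv_pow_half_ge0.
apply: (@is_cvg_seriesZ R^o); apply/cvg_ex; exists (ttilde R [:: q]).
exact: cvg_series_half.
Qed.

Lemma cvg_EulerT p q : (1 < p)%N -> (1 < q)%N ->
  series (fun m => hharm R p m / (half m.+1) ^+ q) @ \oo --> EulerT R p q.
Proof.
move=> p1 q1.
have -> : EulerT R p q = limn (series (fun m => hharm R p m / (half m.+1) ^+ q)).
  by congr (limn _); apply/funext => N; rewrite big_add1.
apply: (@is_cvg_series_bounded_half _ (ttilde R [:: p])) => // m.
by rewrite ger0_norm ?hharm_ge0 ?hharm_le.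
Qed.

Lemma cvg_EulerT2 p1 p2 q : (1 < p1)%N -> (1 < p2)%N -> (1 < q)%N ->
  series (fun m => hharm R p1 m * hharm R p2 m / (half m.+1) ^+ q) @ \oo
    --> EulerT2 R p1 p2 q.
Proof.
move=> hp1 hp2 q1.
have -> : EulerT2 R p1 p2 q =
    limn (series (fun m => hharm R p1 m * hharm R p2 m / (half m.+1) ^+ q)).
  by congr (limn _); apply/funext => N; rewrite big_add1.
apply: (@is_cvg_series_bounded_half _ (ttilde R [:: p1] * ttilde R [:: p2])) => // m.
rewrite normrM ler_pM ?normr_ge0 //.
  by rewrite ger0_norm ?hharm_ge0 ?hharm_le.
by rewrite ger0_norm ?hharm_ge0 ?hharm_le.
Qed.

Lemma inv_pow_nat_ge0 r m : 0 <= (m.+1%:R : R) ^- r.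
Proof. by rewrite invr_ge0 exprn_ge0. Qed.

Lemma cvg_series_zeta r : (1 < r)%N ->
  series (fun m => (m.+1%:R : R) ^- r) @ \oo --> zeta R [:: r].
Proof.
move=> r1; have := cvg_harm R r r1; rewrite harmE shifted_harmE.
by under [fun k => (_ - 0) ^- _]eq_fun do rewrite subr0.
Qed.

Lemma cvg_EulerS s r : (1 < s)%N -> (1 < r)%N ->
  series (fun m => harm R s m.+1 / m.+1%:R ^+ r) @ \oo --> EulerS R s r.
Proof.
move=> s1 r1.
have -> : EulerS R s r = limn (series (fun m => harm R s m.+1 / m.+1%:R ^+ r)).
  by congr (limn _); apply/funext => N; rewrite big_add1.
apply: (@cvg_series_dominated _ _ (fun m => zeta R [:: s] * m.+1%:R ^- r)).
  move=> m; rewrite normrM (ger0_norm (inv_pow_nat_ge0 _ _)).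
  by rewrite ler_wpM2r ?inv_pow_nat_ge0 // ger0_norm ?harm_ge0 ?harm_le.
apply: (@is_cvg_seriesZ R^o); apply/cvg_ex; exists (zeta R [:: r]).
exact: cvg_series_zeta.
Qed.

Lemma harm0 s : harm R s 0 = 0.
Proof. by rewrite /harm big_geq. Qed.

(** For fixed [n] the truncated harmonic number tends to a zeta value, so in the limit the
    convolution splits into a product; the bound [zeta(s) * n.+1^-r] permits the exchange. *)
Lemma cvg_truncated_zeta_prod s r : (1 < s)%N -> (1 < r)%N ->
  (fun N => \sum_(0 <= n < N) harm R s (N - n.+1) * n.+1%:R ^- r) @ \oo
    --> zeta R [:: s] * zeta R [:: r].
Proof.
move=> s1 r1.
apply: (@tannery _ (fun N n => harm R s (N - n.+1) * n.+1%:R ^- r)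
  (fun n => zeta R [:: s] * n.+1%:R ^- r)
  (fun n => zeta R [:: s] * n.+1%:R ^- r)).
(* Truncated subtraction makes the terms with [n >= N] vanish, so each row is a finite sum read as a
   series. *)
- move=> N; apply: (@cvg_cst_of_bound _ _ _ N) => M NM.
  rewrite /series /= (@big_cat_nat _ _ _ N) //= [X in _ + X]big_nat_cond.
  rewrite [X in _ + X]big1 ?addr0 // => n /andP[/andP[Nn _] _].
  rewrite (eqP (_ : N - n.+1 == 0)%N) ?subn_eq0 ?leqW //.
  by rewrite harm0 mul0r.
- move=> n; apply: cvgMr_tmp.
  apply: (cvg_comp (fun N => (N - n.+1)%N) (harm R s)); first exact: cvg_subnr.
  exact: cvg_harm.
- move=> N n; rewrite normrM (ger0_norm (inv_pow_nat_ge0 _ _)).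
  by rewrite ler_wpM2r ?inv_pow_nat_ge0 // ger0_norm ?harm_ge0 ?harm_le.
- apply: (@is_cvg_seriesZ R^o); apply/cvg_ex; exists (zeta R [:: r]).
  exact: cvg_series_zeta.
have -> : series (fun n => zeta R [:: s] * n.+1%:R ^- r) =
    fun N => zeta R [:: s] * series (fun n => n.+1%:R ^- r) N.
  by apply/funext => N; rewrite /series /= mulr_sumr.
by apply: cvgMl_tmp; exact: cvg_series_zeta.
Qed.

(** The indices above [n] give the first harmonic number, those below are reflected and give the
    second. They account for the product [zeta * zeta] and for [EulerS], respectively, in the
    bracket of [mixed_coef]. *)
Lemma regular_sum s N n : (n <= N)%N ->
  \sum_(0 <= k < N.+1 | k != n) (k%:R - n%:R) ^- s
  = harm R s (N - n) + (-1) ^+ s * harm R s n :> R.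
Proof.
move=> nN; rewrite -{1}(subnKC nN) big_mkcond /=.
elim: (N - n)%N => [|M IH].
  rewrite harm0 add0r addn0 big_nat_recr //= eqxx addr0.
  rewrite big_nat_rev /= /harm big_add1 mulr_sumr /=.
  apply: eq_big_nat => i /andP[_ iN]; rewrite add0n -inv_pow_opp natrB //.
  rewrite ifT; last by rewrite neq_ltn; apply/orP; left; lia.
  by congr (_ ^- s); ring.
rewrite addnS big_nat_recr //= IH /harm [in RHS]big_nat_recr //=.
rewrite gtn_eqF ?ltnS ?leq_addr //= -addnS.
have -> : (n + M.+1)%:R - n%:R = M.+1%:R :> R by rewrite natrD addrAC subrr add0r.
by rewrite addrAC.
Qed.

Lemma regular_coef_harm p N n i : (n <= N)%N ->
  regular_coef R p N n i = (-1) ^+ i * 'C((p + i).-1, i)%:R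
    * (harm R (p + i) (N - n) + (-1) ^+ (p + i) * harm R (p + i) n).
Proof. by move=> nN; rewrite -regular_sum // mulr_sumr. Qed.

(** Taylor coefficients at [w = 0] of the sum of [(k + w)^-p] over all [k >= 1]. *)
Definition zeta_coef p i : R :=
  (-1) ^+ i * 'C((p + i).-1, i)%:R * zeta R [:: (p + i)%N].

Lemma cvg_regular_coef0 p i : (1 < p)%N ->
  (fun N => regular_coef R p N 0 i) @ \oo --> zeta_coef p i.
Proof.
move=> p1; under eq_fun do rewrite regular_coef_harm // subn0.
apply: cvgMl_tmp; rewrite -[zeta R _]addr0; apply: cvgD.
  by apply: cvg_harm; rewrite ltn_addr.
by rewrite harm0 mulr0; exact: cvg_cst.
Qed.

Lemma inv_pow_coef_opp q n i :
  al q (- n%:R) i = (-1) ^+ q * 'C((q + i).-1, i)%:R * n%:R ^- (q + i).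
Proof.
rewrite /inv_pow_coef inv_pow_opp exprD.
have : (-1) ^+ i * (-1) ^+ i = 1 :> R by rewrite -exprMn mulrNN mulr1 expr1n.
by move=> h; ring: h.
Qed.

Lemma cvg_inv_pow_coef_opp q i : (1 < q)%N ->
  (fun N => \sum_(1 <= n < N.+1) al q (- n%:R) i) @ \oo
    --> (-1) ^+ q * 'C((q + i).-1, i)%:R * zeta R [:: (q + i)%N].
Proof.
move=> q1; under eq_fun do under eq_bigr do rewrite inv_pow_coef_opp.
under eq_fun do rewrite -mulr_sumr.
by apply: cvgMl_tmp; apply: cvg_harm; rewrite ltn_addr.
Qed.

Definition mixed_coef p q j k : R :=
  ((-1) ^+ j * 'C((p + j).-1, j)%:R) * ((-1) ^+ q * 'C((q + k).-1, k)%:R)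
  * (zeta R [:: (p + j)%N] * zeta R [:: (q + k)%N]
     + (-1) ^+ (p + j) * EulerS R (p + j) (q + k)).

Lemma cvg_mixed_coef p q j k : (1 < p)%N -> (1 < q)%N ->
  (fun N => \sum_(1 <= n < N.+1) regular_coef R p N n j * al q (- n%:R) k) @ \oo
    --> mixed_coef p q j k.
Proof.
move=> p1 q1; set c : R := (-1) ^+ j * 'C((p + j).-1, j)%:R.
set d : R := (-1) ^+ q * 'C((q + k).-1, k)%:R.
have -> : (fun N => \sum_(1 <= n < N.+1) regular_coef R p N n j * al q (- n%:R) k)
    = fun N => c * d *
      (\sum_(0 <= n < N) harm R (p + j) (N - n.+1) * n.+1%:R ^- (q + k)
       + (-1) ^+ (p + j) *
         series (fun m => harm R (p + j) m.+1 / m.+1%:R ^+ (q + k)) N).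
  apply/funext => N; rewrite /series /= mulr_sumr -big_split mulr_sumr big_add1.
  apply: eq_big_nat => n /andP[_ nN].
  rewrite regular_coef_harm // inv_pow_coef_opp -/c -/d /=; ring.
apply: cvgMl_tmp; apply: cvgD.
  by apply: cvg_truncated_zeta_prod; rewrite ltn_addr.
by apply: cvgMl_tmp; apply: cvg_EulerS; rewrite ltn_addr.
Qed.

Definition pole_sum p1 p2 q : R :=
  half_zeta R (p1 + p2 + q)
  + ppv (zeta_coef p2) (p1 + q) + ppv (zeta_coef p1) (p2 + q)
  + ppv (cauchy_prod R (zeta_coef p1) (zeta_coef p2)) q
  + (ppv (fun i => (-1) ^+ q * 'C((q + i).-1, i)%:R * zeta R [:: (q + i)%N])
       (p1 + p2)
     + ppv (fun i => \sum_(0 <= j < i.+1) mixed_coef p1 q j (i - j)) p2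
     + ppv (fun i => \sum_(0 <= j < i.+1) mixed_coef p2 q j (i - j)) p1).

Lemma cvg_principal_part_sum_value (c : nat -> nat -> R) (c' : nat -> R) p :
    (forall i, (fun N => c N i) @ \oo --> c' i) ->
  (fun N => ppv (c N) p) @ \oo --> ppv c' p.
Proof. by move=> cc; apply: cvg_sum_nat => i _; apply: cvgMr_tmp. Qed.

Lemma principal_part_sum_value_big (c : nat -> nat -> R) p N :
  \sum_(1 <= n < N.+1) ppv (c n) p = ppv (fun i => \sum_(1 <= n < N.+1) c n i) p.
Proof.
rewrite /principal_part_sum_value exchange_big /=.
by apply: eq_bigr => i _; rewrite mulr_suml.
Qed.

Lemma cvg_truncated_pole_sum p1 p2 q : (1 < p1)%N -> (1 < p2)%N -> (1 < q)%N ->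
  truncated_pole_sum R p1 p2 q @ \oo --> pole_sum p1 p2 q.
Proof.
move=> hp1 hp2 hq; rewrite /truncated_pole_sum.
(* [ppv] is linear in the coefficients and does not see the pole, so the sum over [n] moves onto the
   coefficients. *)
under eq_fun do rewrite !big_split !principal_part_sum_value_big.
have mixed p r : (1 < p)%N -> (fun N => ppv (fun i => \sum_(1 <= n < N.+1)
      cauchy_prod R (regular_coef R p N n) (al q (- n%:R)) i) r) @ \oo
    --> ppv (fun i => \sum_(0 <= j < i.+1) mixed_coef p q j (i - j)) r.
  move=> p_gt1; apply: cvg_principal_part_sum_value => i.
  under eq_fun do rewrite /cauchy_prod exchange_big /=.
  by apply: cvg_sum_nat => j _; exact: cvg_mixed_coef.
apply: cvgD; last first.
  apply: cvgD; last exact: mixed.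
  apply: cvgD; last exact: mixed.
  by apply: cvg_principal_part_sum_value => i; exact: cvg_inv_pow_coef_opp.
apply: cvgD; last first.
  apply: cvg_principal_part_sum_value => i; apply: cvg_sum_nat => j _.
  by apply: cvgM; exact: cvg_regular_coef0.
apply: cvgD; last first.
  by apply: cvg_principal_part_sum_value => i; exact: cvg_regular_coef0.
apply: cvgD; first exact: cvg_cst.
by apply: cvg_principal_part_sum_value => i; exact: cvg_regular_coef0.
Qed.

(** The limit function summed over all half-integers, with [hharm p m.+1] split into [hharm p m] and
    its last term; the last five summands come from these last terms. *)
Definition half_integer_total p1 p2 q : R :=
  (1 + (-1) ^+ q) * ttilde R [:: p1] * ttilde R [:: p2] * ttilde R [:: q]
  + ((-1) ^+ (p2 + q) - 1) * ttilde R [:: p1] * EulerT R p2 q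
  + ((-1) ^+ (p1 + q) - 1) * ttilde R [:: p2] * EulerT R p1 q
  + (1 + (-1) ^+ (p1 + p2 + q)) * EulerT2 R p1 p2 q
  + (-1) ^+ (p2 + q) * ttilde R [:: p1] * ttilde R [:: (p2 + q)%N]
  + (-1) ^+ (p1 + q) * ttilde R [:: p2] * ttilde R [:: (p1 + q)%N]
  + (-1) ^+ (p1 + p2 + q) * EulerT R p1 (p2 + q)
  + (-1) ^+ (p1 + p2 + q) * EulerT R p2 (p1 + q)
  + (-1) ^+ (p1 + p2 + q) * ttilde R [:: (p1 + p2 + q)%N].

Lemma cvg_truncated_pole_sum_half p1 p2 q :
    (1 < p1)%N -> (1 < p2)%N -> (1 < q)%N ->
  truncated_pole_sum R p1 p2 q @ \oo --> half_integer_total p1 p2 q.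
Proof.
move=> hp1 hp2 hq; have q0 : (0 < q)%N by exact: ltnW.
pose t1 := ttilde R [:: p1]; pose t2 := ttilde R [:: p2].
pose v m := (t1 - hharm R p1 m) * (t2 - hharm R p2 m) * (half m.+1) ^- q
  + (t1 + (-1) ^+ p1 * hharm R p1 m.+1) * (t2 + (-1) ^+ p2 * hharm R p2 m.+1)
    * (- half m.+1) ^- q.
(* Each truncated sum is at most [2 * ttilde(p)]; the outer 2 counts the two signs of the
   half-integer. *)
pose b m := 2 * ((2 * t1) * (2 * t2)) * (half m.+1) ^- q.
apply: (@tannery _ (fun N m => truncated_product R p1 p2 q N (half m.+1)
    + truncated_product R p1 p2 q N (- half m.+1)) v b).
- by move=> N; exact: cvg_half_sum_truncated_product.
- move=> m; apply: cvgD; apply: cvgMr_tmp.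
    by apply: cvgM; exact: cvg_truncated_sum_pos.
  by apply: cvgM; exact: cvg_truncated_sum_neg.
- move=> N m; apply: le_trans (ler_normD _ _) _; rewrite /truncated_product.
  rewrite inv_pow_opp !normrM normrX normrN1 expr1n mul1r.
  rewrite (ger0_norm (inv_pow_half_ge0 _ _)) -mulrDl ler_wpM2r ?inv_pow_half_ge0 //.
  rewrite mulr2n mulrDl !mul1r lerD //.
    by rewrite ler_pM ?normr_ge0 ?truncated_sum_pos_bound.
  by rewrite ler_pM ?normr_ge0 ?truncated_sum_neg_bound.
- apply: (@is_cvg_seriesZ R^o); apply/cvg_ex; exists (ttilde R [:: q]).
  exact: cvg_series_half.
have hS p m : hharm R p m.+1 = hharm R p m + (half m.+1) ^- p.
  by rewrite /hharm [in LHS]big_nat_recr.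
have -> : series v = fun N =>
  (1 + (-1) ^+ q) * t1 * t2 * series (fun m => (half m.+1) ^- q) N
  + ((-1) ^+ (p2 + q) - 1) * t1
      * series (fun m => hharm R p2 m / (half m.+1) ^+ q) N
  + ((-1) ^+ (p1 + q) - 1) * t2
      * series (fun m => hharm R p1 m / (half m.+1) ^+ q) N
  + (1 + (-1) ^+ (p1 + p2 + q))
      * series (fun m => hharm R p1 m * hharm R p2 m / (half m.+1) ^+ q) N
  + (-1) ^+ (p2 + q) * t1 * series (fun m => (half m.+1) ^- (p2 + q)) N
  + (-1) ^+ (p1 + q) * t2 * series (fun m => (half m.+1) ^- (p1 + q)) N
  + (-1) ^+ (p1 + p2 + q)
      * series (fun m => hharm R p1 m / (half m.+1) ^+ (p2 + q)) N
  + (-1) ^+ (p1 + p2 + q)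
      * series (fun m => hharm R p2 m / (half m.+1) ^+ (p1 + q)) N
  + (-1) ^+ (p1 + p2 + q) * series (fun m => (half m.+1) ^- (p1 + p2 + q)) N.
  apply/funext => N; rewrite /series /= !mulr_sumr -!big_split /=.
  apply: eq_bigr => m _; rewrite /v !hS inv_pow_opp !exprD !invfM.
  ring.
have gt1 p r : (1 < p)%N -> (1 < p + r)%N by move=> h; rewrite ltn_addr.
apply: cvgD; last by apply: cvgMl_tmp; apply: cvg_series_half; rewrite ?gt1.
apply: cvgD; last by apply: cvgMl_tmp; apply: cvg_EulerT; rewrite ?gt1.
apply: cvgD; last by apply: cvgMl_tmp; apply: cvg_EulerT; rewrite ?gt1.
apply: cvgD; last by apply: cvgMl_tmp; apply: cvg_series_half; rewrite ?gt1.
apply: cvgD; last by apply: cvgMl_tmp; apply: cvg_series_half; rewrite ?gt1.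
apply: cvgD; last by apply: cvgMl_tmp; apply: cvg_EulerT2; rewrite ?gt1.
apply: cvgD; last by apply: cvgMl_tmp; apply: cvg_EulerT; rewrite ?gt1.
apply: cvgD; last by apply: cvgMl_tmp; apply: cvg_EulerT; rewrite ?gt1.
by apply: cvgMl_tmp; exact: cvg_series_half.
Qed.

(** Uniqueness of limits: both values are limits of the single sequence [truncated_pole_sum]. *)
Lemma half_integer_total_pole_sum p1 p2 q :
    (1 < p1)%N -> (1 < p2)%N -> (1 < q)%N ->
  half_integer_total p1 p2 q = pole_sum p1 p2 q.
Proof.
move=> hp1 hp2 hq.
have h1 := @cvg_truncated_pole_sum_half p1 p2 q hp1 hp2 hq.
have h2 := @cvg_truncated_pole_sum p1 p2 q hp1 hp2 hq.
by rewrite -(cvg_lim _ h1) // -(cvg_lim _ h2).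
Qed.

End PoleSums.

(** * The formula and the generated algebra *)

Section Reindexing.
Variable R : realType.
Implicit Types (m n p q r s i j k N : nat).

Local Notation ppv := (principal_part_sum_value R).

Lemma triangle_sum (G : nat -> nat -> R) n :
  \sum_(0 <= i < n) \sum_(0 <= j < i.+1) G j (i - j)%N
  = \sum_(0 <= j < n) \sum_(0 <= m < n - j) G j m.
Proof.
elim: n => [|n IH]; first by rewrite !big_geq.
rewrite big_nat_recr //= IH.
have -> : \sum_(0 <= j < n) \sum_(0 <= m < n - j) G j m
    = \sum_(0 <= j < n.+1) \sum_(0 <= m < n - j) G j m.
  by rewrite big_nat_recr //= subnn [X in _ + X]big_geq // addr0.
rewrite -big_split /=; apply: eq_big_nat => j /andP[_ jn].
by rewrite subSn // big_nat_recr.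
Qed.

(** Explains the factors 2 and the even arguments [2 * k] of the final formula: [1 + (-1)^l] is 2
    for even [l] and 0 for odd [l]. The range only has to contain [l / 2]. *)
Lemma even_index_sum (X : nat -> R) l K : (0 < l)%N -> (l < 2 * K)%N ->
  2 * (\sum_(1 <= k < K | (2 * k == l)%N) X (2 * k)%N) = (1 + (-1) ^+ l) * X l.
Proof.
move=> l0 lK; case: (boolP (odd l)) => ol; rewrite -signr_odd.
  rewrite ol expr1 subrr mul0r big_pred0 ?mulr0 // => k.
  by apply/eqP => h; move: ol; rewrite -h oddM.
rewrite (negbTE ol) expr0; congr (_ * _).
rewrite (eq_bigl (pred1 l./2)); last by move=> k; apply/eqP/eqP => /=; lia.
rewrite -big_filter (filter_pred1_uniq (iota_uniq _ _)).
  by rewrite big_seq1; congr (X _); lia.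
by rewrite mem_index_iota; lia.
Qed.

Lemma bin_pred_sub p i : (0 < p)%N ->
  'C((p + i).-1, i) = 'C(p + i.+1 - 2, p - 1).
Proof.
move=> p0; rewrite -bin_sub; last by lia.
by congr ('C(_, _)); lia.
Qed.

(** The factor survives only if [i] and [s] have the same parity, so the sign can be pulled out of a
    sum over [i]. *)
Lemma sign_even_factor i s : (i <= s)%N ->
  (-1) ^+ i * (1 + (-1) ^+ (s - i)) = (-1) ^+ s * (1 + (-1) ^+ (s - i)) :> R.
Proof.
move=> le_is; rewrite -{2}(subnKC le_is) exprD.
have : (-1) ^+ (s - i) * (-1) ^+ (s - i) = 1 :> R.
  by rewrite -exprMn mulrNN mulr1 expr1n.
by move=> h; ring: h.
Qed.

Lemma half_zeta_succ l : half_zeta R l.+1 = - ((-1) ^+ l - 1) * ttilde R [:: l.+1].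
Proof. by rewrite /half_zeta exprS mulN1r; congr (_ * _); ring. Qed.

Lemma zeta_coef_value p s : (0 < p)%N ->
  ppv (zeta_coef R p) s = (-1) ^+ s * (2 *
    (\sum_(1 <= k1 < s + 1) \sum_(1 <= k2 < s + 1 | (k1 + 2 * k2 == s + 1)%N)
       'C(p + k1 - 2, p - 1)%:R
         * zeta R [:: (p + k1 - 1)%N] * ttilde R [:: (2 * k2)%N])).
Proof.
move=> p0; rewrite !mulr_sumr addn1 big_add1 /=.
apply: eq_big_nat => i /andP[_ lt_is].
(* With [k1 = i + 1] the constraint reads [2 * k2 = s - i], the order of the pole term. *)
rewrite -!mulr_sumr (eq_bigl (fun k => (2 * k == s - i)%N)); last first.
  by move=> k; apply/eqP/eqP; lia.
rewrite [2 * _]mulrCA (even_index_sum (fun n => ttilde R [:: n])); try lia.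
rewrite /zeta_coef /half_zeta bin_pred_sub //.
have -> : (p + i.+1 - 1)%N = (p + i)%N by lia.
have h := sign_even_factor i s (ltnW lt_is).
set B := 'C(_, _)%:R; set Z := zeta _ _; set t := ttilde _ _.
transitivity ((-1) ^+ i * (1 + (-1) ^+ (s - i)) * (B * Z * t)); first by ring.
by rewrite h; ring.
Qed.

Lemma cauchy_zeta_coef_value p1 p2 q : (0 < p1)%N -> (0 < p2)%N ->
  ppv (cauchy_prod R (zeta_coef R p1) (zeta_coef R p2)) q = (-1) ^+ q * (2 *
    (\sum_(1 <= k1 < q + 2) \sum_(1 <= k2 < q + 2)
       \sum_(1 <= k3 < q + 2 | (k1 + k2 + 2 * k3 == q + 2)%N)
         'C(p1 + k1 - 2, p1 - 1)%:R * 'C(p2 + k2 - 2, p2 - 1)%:R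
           * zeta R [:: (p1 + k1 - 1)%N] * zeta R [:: (p2 + k2 - 1)%N]
           * ttilde R [:: (2 * k3)%N])).
Proof.
move=> h1 h2.
pose G j m := zeta_coef R p1 j * zeta_coef R p2 m * half_zeta R (q - (j + m)).
have -> : ppv (cauchy_prod R (zeta_coef R p1) (zeta_coef R p2)) q =
    \sum_(0 <= i < q) \sum_(0 <= j < i.+1) G j (i - j)%N.
  apply: eq_bigr => i _; rewrite mulr_suml; apply: eq_big_nat => j /andP[_ ji].
  by rewrite /G subnKC.
rewrite triangle_sum !mulr_sumr addn2 big_add1 /= [RHS]big_nat_recr //=.
(* This is [k1 = q + 1], which would force [k2 + 2 * k3 = 1] with positive indices. *)
rewrite [X in _ + X](_ : _ = 0); last first.
  rewrite big1_seq ?mulr0 // => k2; rewrite mem_index_iota => /andP[k20 _].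
  rewrite big1_seq ?mulr0 // => k3; rewrite mem_index_iota => /andP[/eqP hk].
  lia.
rewrite addr0; apply: eq_big_nat => j /andP[_ jq].
rewrite !mulr_sumr big_add1 /= [RHS](@big_cat_nat _ _ _ (q - j)) //=; last by lia.
(* For [m >= q - j] one has [k1 + k2 >= q + 2], and no [k3 >= 1] is left. *)
rewrite [X in _ = _ + X](_ : _ = 0) ?addr0; last first.
  rewrite big_nat_cond big1 // => m /andP[/andP[qm _] _].
  rewrite big1_seq ?mulr0 // => k3; rewrite mem_index_iota => /andP[/eqP hk].
  lia.
apply: eq_big_nat => m /andP[_ mq].
rewrite -!mulr_sumr (eq_bigl (fun k => (2 * k == q - (j + m))%N)); last first.
  by move=> k; apply/eqP/eqP; lia.
rewrite [2 * _]mulrCA (even_index_sum (fun n => ttilde R [:: n])); try lia.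
rewrite /G /zeta_coef /half_zeta !bin_pred_sub //.
have -> : (p1 + j.+1 - 1)%N = (p1 + j)%N by lia.
have -> : (p2 + m.+1 - 1)%N = (p2 + m)%N by lia.
have jmq : (j + m <= q)%N by lia.
have h := sign_even_factor (j + m) q jmq.
set B1 := 'C(_, _)%:R; set B2 := 'C(_, _)%:R.
set Z1 := zeta _ _; set Z2 := zeta _ _; set t := ttilde _ _.
transitivity ((-1) ^+ (j + m) * (1 + (-1) ^+ (q - (j + m)))
    * (B1 * B2 * Z1 * Z2 * t)); first by rewrite exprD; ring.
by rewrite h; ring.
Qed.

Lemma diagonal_coef_value q n : (0 < q)%N ->
  ppv (fun i => (-1) ^+ q * 'C((q + i).-1, i)%:R * zeta R [:: (q + i)%N]) n
  = - (-1) ^+ q * (\sum_(0 <= l < n)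
      ((-1) ^+ l - 1) * 'C(n + q - l - 2, q - 1)%:R
        * ttilde R [:: l.+1] * zeta R [:: (n + q - l - 1)%N]).
Proof.
move=> q0; rewrite /principal_part_sum_value big_nat_rev /= mulr_sumr.
apply: eq_big_nat => l /andP[_ ln]; rewrite add0n bin_pred_sub //.
have -> : (n - (n - l.+1))%N = l.+1 by lia.
have -> : (q + (n - l.+1))%N = (n + q - l - 1)%N by lia.
have -> : (q + (n - l.+1).+1 - 2)%N = (n + q - l - 2)%N by lia.
by rewrite half_zeta_succ; ring.
Qed.

Lemma mixed_coef_value p q r : (0 < p)%N -> (0 < q)%N ->
  ppv (fun i => \sum_(0 <= j < i.+1) mixed_coef R p q j (i - j)) r
  = (-1) ^+ q *
     (\sum_(1 <= k < r.+1) (-1) ^+ k * 'C(k + p - 2, p - 1)%:R *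
        (\sum_(0 <= l < (r - k).+1)
          ((-1) ^+ l - 1) * 'C(r + q - k - l - 1, q - 1)%:R
            * ttilde R [:: l.+1]
            * (zeta R [:: (k + p - 1)%N] * zeta R [:: (r + q - k - l)%N]
               + (-1) ^+ (k + p - 1) * EulerS R (k + p - 1) (r + q - k - l)))).
Proof.
move=> p0 q0.
pose G j m := mixed_coef R p q j m * half_zeta R (r - (j + m)).
have -> : ppv (fun i => \sum_(0 <= j < i.+1) mixed_coef R p q j (i - j)) r =
    \sum_(0 <= i < r) \sum_(0 <= j < i.+1) G j (i - j)%N.
  apply: eq_bigr => i _; rewrite mulr_suml; apply: eq_big_nat => j /andP[_ ji].
  by rewrite /G subnKC.
rewrite triangle_sum !mulr_sumr big_add1 /=; apply: eq_big_nat => j /andP[_ jr].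
rewrite -subSn // subSS big_nat_rev /= !mulr_sumr.
apply: eq_big_nat => l /andP[_ lr]; rewrite add0n /G /mixed_coef !bin_pred_sub //.
have -> : (r - (j + (r - j - l.+1)))%N = l.+1 by lia.
have -> : (q + (r - j - l.+1))%N = (r + q - j.+1 - l)%N by lia.
have -> : (q + (r - j - l.+1).+1 - 2)%N = (r + q - j.+1 - l - 1)%N by lia.
have -> : (p + j.+1 - 2)%N = (j.+1 + p - 2)%N by lia.
have -> : (j.+1 + p - 1)%N = (p + j)%N by lia.
by rewrite half_zeta_succ exprS; ring.
Qed.

End Reindexing.

(** * Reduction to single and double values *)

Section GeneratedAlgebra.
Variable R : realType.
Implicit Types (m n p q r s i j k N : nat).

Lemma ttilde_zeta s : (1 < s)%N ->
  ttilde R [:: s] = (2 ^+ s - 1) * zeta R [:: s].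
Proof.
move=> s1.
(* As [n - 1/2 = (2n - 1) / 2], the sum runs over odd numbers up to the factor [2^s]: all numbers up
   to [2N] minus the even ones. *)
have E : hharm R s = fun N => 2 ^+ s * harm R s (2 * N)%N - harm R s N.
  apply/funext; elim=> [|N IH].
    by rewrite /hharm /harm !big_geq // mulr0 subr0.
  rewrite /hharm big_nat_recr //= -/(hharm R s N) IH.
  have -> : (2 * N.+1)%N = (2 * N).+2 by lia.
  have hS n : harm R s n.+1 = harm R s n + n.+1%:R ^- s.
    by rewrite /harm [in LHS]big_nat_recr.
  rewrite !hS.
  have -> : (2 * N).+2%:R = 2 * N.+1%:R :> R by rewrite -natrM; congr _%:R; lia.
  have -> : N.+1%:R - 2^-1 = (2 * N).+1%:R / 2 :> R.
    by rewrite -!natr1 natrM; field.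
  rewrite expr_div_n invf_div exprMn invfM.
  have h : 2 ^+ s != 0 :> R by rewrite expf_neq0.
  have hV := divff h.
  by ring: hV.
have h1 := cvg_hharm R s s1; have h2 := cvg_harm R s s1.
have h3 : (fun N => harm R s (2 * N)%N) @ \oo --> zeta R [:: s].
  apply: (cvg_comp (fun N => (2 * N)%N) (harm R s)); last exact: h2.
  by move=> P [K _ KP]; exists K => // N /= KN; apply: KP => /=; lia.
have h4 : hharm R s @ \oo --> 2 ^+ s * zeta R [:: s] - zeta R [:: s].
  by rewrite E; apply: cvgB => //; exact: cvgMl_tmp.
rewrite -(cvg_lim _ h1) // (cvg_lim _ h4) //; ring.
Qed.

Lemma EulerT_ttilde p q : (1 < p)%N -> (1 < q)%N ->
  EulerT R p q = ttilde R [:: q; p].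
Proof.
move=> p1 q1; have := cvg_EulerT R p q p1 q1.
have -> : series (fun m => hharm R p m / (m.+1%:R - 2^-1) ^+ q) =
    (fun N => nested_sum 2^-1 [:: q; p] N.+1).
  apply/funext => N; rewrite /series [RHS]/= big_add1 /=.
  apply: eq_bigr => m _; rewrite mulrC; congr (_ * _).
  by apply: eq_bigr => k _; rewrite mulr1.
by rewrite cvg_shiftS => /cvg_lim <-.
Qed.

(** [harm s n] includes the diagonal term [k = n], which the strict inequality in the double zeta
    value omits; the diagonal sums to [zeta(s + r)]. *)
Lemma EulerS_zeta s r : (1 < s)%N -> (1 < r)%N ->
  EulerS R s r = zeta R [:: r; s] + zeta R [:: (s + r)%N].
Proof.
move=> s1 r1; have hS := cvg_EulerS R s r s1 r1.
have hz := cvg_harm R (s + r) (ltn_addr r s1).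
suff -> : zeta R [:: r; s] = EulerS R s r - zeta R [:: (s + r)%N] by rewrite subrK.
have : (fun N => nested_sum (0 : R) [:: r; s] N.+1) @ \oo
    --> EulerS R s r - zeta R [:: (s + r)%N].
  have -> : (fun N => nested_sum (0 : R) [:: r; s] N.+1) = fun N =>
      series (fun m => harm R s m.+1 / m.+1%:R ^+ r) N - harm R (s + r) N.
    apply/funext => N; rewrite [LHS]/= /series /= [harm R (s + r) N]/harm.
    rewrite !big_add1 /= -sumrB.
    apply: eq_bigr => m _; rewrite subr0 exprD invfM.
    rewrite [in RHS]/harm [in RHS]big_nat_recr //= mulrDl addrK mulrC.
    by congr (_ * _); apply: eq_bigr => k _; rewrite mulr1 subr0.
  exact: cvgB.
by rewrite cvg_shiftS => /cvg_lim <-.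
Qed.

End GeneratedAlgebra.

(** * Closure of a rational subalgebra containing the generators *)

Section SubalgebraClosure.
Variables (R : realType) (A : set R).
Hypothesis HA : Qsubalgebra A.

Lemma QsubD x y : A x -> A y -> A (x + y).
Proof. by case: HA => _ + _; apply. Qed.

Lemma QsubM x y : A x -> A y -> A (x * y).
Proof. by case: HA => _ _; apply. Qed.

Lemma Qsub_nat n : A n%:R.
Proof. by case: HA => /(_ n%:R) + _ _; rewrite ratr_nat. Qed.

Lemma QsubN x : A x -> A (- x).
Proof.
move=> Ax; rewrite -mulN1r; apply: QsubM => //.
by case: HA => /(_ (-1)) + _ _; rewrite rmorphN1.
Qed.

Lemma QsubX x n : A x -> A (x ^+ n).
Proof.
move=> Ax; elim: n => [|n IH]; first by rewrite expr0; exact: (Qsub_nat 1).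
by rewrite exprS; exact: QsubM.
Qed.

Lemma Qsub_sum (P : pred nat) (F : nat -> R) m n :
    (forall i, (m <= i < n)%N -> P i -> A (F i)) ->
  A (\sum_(m <= i < n | P i) F i).
Proof.
move=> AF; rewrite big_nat_cond; apply: big_ind.
- exact: (Qsub_nat 0).
- exact: QsubD.
- by move=> i /andP[mn Pi]; exact: AF.
Qed.

Hypothesis gen :
  zeta_values R `|` double_zeta_values R `|` double_ttilde_values R `<=` A.

Lemma Qsub_zeta s : (1 < s)%N -> A (zeta R [:: s]).
Proof. by move=> s1; apply: gen; left; left; exists s. Qed.

Lemma Qsub_ttilde s : (1 < s)%N -> A (ttilde R [:: s]).
Proof.
move=> s1; rewrite ttilde_zeta //; apply: QsubM; last exact: Qsub_zeta.
by apply: QsubD; [exact/QsubX/(Qsub_nat 2) | exact/QsubN/(Qsub_nat 1)].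
Qed.

Lemma Qsub_EulerT p q : (1 < p)%N -> (1 < q)%N -> A (EulerT R p q).
Proof.
move=> p1 q1; rewrite EulerT_ttilde //; apply: gen; right.
by exists q, p; split => //; exact: ltnW.
Qed.

Lemma Qsub_EulerS s r : (1 < s)%N -> (1 < r)%N -> A (EulerS R s r).
Proof.
move=> s1 r1; rewrite EulerS_zeta //; apply: QsubD.
  by apply: gen; left; right; exists r, s; split => //; exact: ltnW.
by apply: Qsub_zeta; rewrite ltn_addr.
Qed.

End SubalgebraClosure.

Theorem theorem2p8 (R : realType) (p1 p2 q : nat)
  (hp1 : (1 < p1)%N) (hp2 : (1 < p2)%N) (hq : (1 < q)%N) :
  Qalgebra_generated
    (zeta_values R `|` double_zeta_values R `|` double_ttilde_values R)
    ((1 + (-1) ^+ (p1 + p2 + q)) * EulerT2 R p1 p2 q)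
  /\
  (1 + (-1) ^+ (p1 + p2 + q)) * EulerT2 R p1 p2 q =
    - EulerT R p1 (p2 + q) - EulerT R p2 (p1 + q)
    - (-1) ^+ (p1 + p2) * (1 + (-1) ^+ q)
        * ttilde R [:: p1] * ttilde R [:: p2] * ttilde R [:: q]
    + (-1) ^+ p1 * ((-1) ^+ (p2 + q) - 1) * ttilde R [:: p1] * EulerT R p2 q
    + (-1) ^+ p2 * ((-1) ^+ (p1 + q) - 1) * ttilde R [:: p2] * EulerT R p1 q
    - (-1) ^+ p1 * ttilde R [:: p1] * ttilde R [:: (p2 + q)%N]
    - (-1) ^+ p2 * ttilde R [:: p2] * ttilde R [:: (p1 + q)%N]
    - (-1) ^+ (p1 + p2) *
        (\sum_(0 <= l < p1 + p2)
          ((-1) ^+ l - 1) * 'C(p1 + p2 + q - l - 2, q - 1)%:R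
            * ttilde R [:: l.+1] * zeta R [:: (p1 + p2 + q - l - 1)%N])
    + (-1) ^+ (p1 + p2) *
        (\sum_(1 <= k < p2.+1) (-1) ^+ k * 'C(k + p1 - 2, p1 - 1)%:R *
          (\sum_(0 <= l < (p2 - k).+1)
            ((-1) ^+ l - 1) * 'C(p2 + q - k - l - 1, q - 1)%:R
              * ttilde R [:: l.+1]
              * (zeta R [:: (k + p1 - 1)%N] * zeta R [:: (p2 + q - k - l)%N]
                 + (-1) ^+ (k + p1 - 1)
                     * EulerS R (k + p1 - 1) (p2 + q - k - l))))
    + (-1) ^+ (p1 + p2) *
        (\sum_(1 <= k < p1.+1) (-1) ^+ k * 'C(k + p2 - 2, p2 - 1)%:R *
          (\sum_(0 <= l < (p1 - k).+1)
            ((-1) ^+ l - 1) * 'C(p1 + q - k - l - 1, q - 1)%:R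
              * ttilde R [:: l.+1]
              * (zeta R [:: (k + p2 - 1)%N] * zeta R [:: (p1 + q - k - l)%N]
                 + (-1) ^+ (k + p2 - 1)
                     * EulerS R (k + p2 - 1) (p1 + q - k - l))))
    + (-1) ^+ (p1 + p2 + q) * ttilde R [:: (p1 + p2 + q)%N]
    + (-1) ^+ p1 * 2 *
        (\sum_(1 <= k1 < p2 + q + 1)
          \sum_(1 <= k2 < p2 + q + 1 | (k1 + 2 * k2 == p2 + q + 1)%N)
            'C(p1 + k1 - 2, p1 - 1)%:R
              * zeta R [:: (p1 + k1 - 1)%N] * ttilde R [:: (2 * k2)%N])
    + (-1) ^+ p2 * 2 *
        (\sum_(1 <= k1 < p1 + q + 1)
          \sum_(1 <= k2 < p1 + q + 1 | (k1 + 2 * k2 == p1 + q + 1)%N)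
            'C(p2 + k1 - 2, p2 - 1)%:R
              * zeta R [:: (p2 + k1 - 1)%N] * ttilde R [:: (2 * k2)%N])
    + (-1) ^+ (p1 + p2) * 2 *
        (\sum_(1 <= k1 < q + 2) \sum_(1 <= k2 < q + 2)
          \sum_(1 <= k3 < q + 2 | (k1 + k2 + 2 * k3 == q + 2)%N)
            'C(p1 + k1 - 2, p1 - 1)%:R * 'C(p2 + k2 - 2, p2 - 1)%:R
              * zeta R [:: (p1 + k1 - 1)%N] * zeta R [:: (p2 + k2 - 1)%N]
              * ttilde R [:: (2 * k3)%N]).
Proof.
(* The explicit formula may be assumed for the membership claim, which is then read off its right
   side. *)
apply: (fun PQ : _ /\ _ => conj (PQ.2 PQ.1) PQ.1); split; last first.
  move=> ->; rewrite /Qalgebra_generated /smallest => A [HA gen].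
  (* At [l = 0] the sign factor is 0, which disposes of the unspecified [ttilde [:: 1]]. *)
  have coef (l : nat) (x : R) s : ((0 < l)%N -> A x) ->
      A (((-1) ^+ l - 1) * s%:R * ttilde R [:: l.+1] * x).
    case: l => [_|l Ax].
      by rewrite expr0 subrr !mul0r; exact: (Qsub_nat _ _ HA 0).
    apply: (QsubM _ _ HA); last exact: Ax.
    apply: (QsubM _ _ HA); last exact: Qsub_ttilde.
    apply: (QsubM _ _ HA); last exact: (Qsub_nat _ _ HA).
    apply: (QsubD _ _ HA); last exact/(QsubN _ _ HA)/(Qsub_nat _ _ HA 1).
    exact/(QsubX _ _ HA)/(QsubN _ _ HA)/(Qsub_nat _ _ HA 1).
  have one := Qsub_nat _ _ HA 1.
  repeat lazymatch goal with
  | |- A (((-1) ^+ _ - 1) * _%:R * ttilde R _ * _) => apply: coef => ?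
  | |- A (_ + _) => apply: (QsubD _ _ HA)
  | |- A (- _) => apply: (QsubN _ _ HA)
  | |- A (_ * _) => apply: (QsubM _ _ HA)
  | |- A (_ ^+ _) => apply: (QsubX _ _ HA)
  | |- A (zeta _ _) => by apply: Qsub_zeta => //; lia
  | |- A (ttilde _ _) => by apply: Qsub_ttilde => //; lia
  | |- A (EulerT _ _ _) => by apply: Qsub_EulerT => //; lia
  | |- A (EulerS _ _ _) => by apply: Qsub_EulerS => //; lia
  | |- A 1 => exact: one
  | |- A (_%:R) => exact: (Qsub_nat _ _ HA)
  | |- A _ => apply: (Qsub_sum _ _ HA) => ? ? ?
  end.
have := half_integer_total_pole_sum R p1 p2 q hp1 hp2 hq.
rewrite /pole_sum !zeta_coef_value ?cauchy_zeta_coef_value ?diagonal_coef_value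
  ?mixed_coef_value; try by [exact: ltnW].
rewrite /half_integer_total /half_zeta.
set T12 := EulerT2 _ _ _ _.
set S1 := \sum_(0 <= l < p1 + p2) _.
set S2 := \sum_(1 <= k < p2.+1) _.
set S3 := \sum_(1 <= k < p1.+1) _.
set S4 := \sum_(1 <= k1 < p2 + q + 1) _.
set S5 := \sum_(1 <= k1 < p1 + q + 1) _.
set S6 := \sum_(1 <= k1 < q + 2) _.
(* The three signs become indeterminates with square 1; modulo these relations the rest is a
   polynomial identity. *)
rewrite !exprD; move: (sqrr_sign R p1) (sqrr_sign R p2) (sqrr_sign R q).
move: ((-1) ^+ p1) ((-1) ^+ p2) ((-1) ^+ q) => e1 e2 e3 h1 h2 h3 H.
apply/eqP; rewrite -subr_eq0; move/eqP: H; rewrite -subr_eq0 => /eqP H.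
(* The product of the signs is its own inverse, so multiplying by it undoes the sign carried by the
   limit identity. *)
apply/eqP; rewrite -[RHS](mulr0 (e1 * e2 * e3)) -H.
ring: h1 h2 h3.
Qed.
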